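(* Pushdown model checking for mumbling $H_\mu$ with unique mumbling is undecidable: there is no algorithm that, given a pushdown system $\mathcal{PD}$ and a closed mumbling $H_\mu$ hyperproperty formula $\varphi$ with unique mumbling, decides whether $\mathit{Traces}(\mathcal{PD}) \models \varphi$.
   Context: Fix a finite set $\mathit{AP}$. A trace is an infinite sequence $P_0m_0P_1m_1\dots$ with $P_i\subseteq\mathit{AP}$, $m_i\in\{\mathit{int},\mathit{call},\mathit{ret}\}$; $\mathit{tr}(i)=P_i$. Successor functions: $\mathit{succ}_\mathsf{g}(\mathit{tr},i)=i+1$; $\mathit{succ}_\mathsf{a}(\mathit{tr},i)=i+1$ if $m_i=\mathit{int}$, and if $m_i=\mathit{call}$ the least $j>i$ such that among $m_i,\dots,m_{j-1}$ the numbers of $\mathit{call}$ and $\mathit{ret}$ coincide (undefined if none), undefined if $m_i=\mathit{ret}$; $\mathit{succ}_\mathsf{c}(\mathit{tr},i)$ the largest $j<i$ with $m_j=\mathit{call}$ such that among $m_{j+1},\dots,m_{i-1}$ the numbers of $\mathit{call}$ and $\mathit{ret}$ coincide (undefined if none). A pushdown system is $\mathcal{PD}=(S,S_0,R,L)$ with finite $S$, $S_0\subseteq S$, $L\colon S\to2^{\mathit{AP}}$, finite stack alphabet $\Theta$, bottom symbol $\bot\notin\Theta$, $R\subseteq(S\times S)\cup(S\times S\times\Theta)\cup(S\times\Theta\times S)$. Configurations $(s,u)$, $u\in\Theta^*\bot$; $(s,u)\to_{\mathit{int}}(s',u)$ if $(s,s')\in R$; $(s,u)\to_{\mathit{call}}(s',\theta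 u)$ if $(s,s',\theta)\in R$; $(s,\theta u)\to_{\mathit{ret}}(s',u)$ if $(s,\theta,s')\in R$. A path is $c_0m_0c_1m_1\dots$ with $c_0=(s_0,\bot)$, $s_0\in S_0$, $c_i\to_{m_i}c_{i+1}$; its trace is $L(c_0)m_0L(c_1)m_1\dots$ with $L((s,u))=L(s)$; $\mathit{Traces}(\mathcal{PD})$ is the set of all such traces. Mumbling $H_\mu$ syntax: trace formulae $\delta ::= \mathit{ap}\mid Y\mid\delta\lor\delta\mid\lnot\delta\mid\bigcirc^\mathsf{f}\delta\mid\mu Y.\delta$ ($\mathsf{f}\in\{\mathsf{g},\mathsf{a},\mathsf{c}\}$); multitrace formulae $\psi ::= [\delta]_\pi\mid X\mid\psi\lor\psi\mid\lnot\psi\mid\bigcirc^\Delta\psi\mid\mu X.\psi$, $\Delta$ mapping trace variables to trace formulae; hyperproperty formulae $\varphi ::= \exists\pi.\varphi\mid\forall\pi.\varphi\mid\psi$; fixpoint variables positive; closed = all variables bound. Semantics: $\llbracket\delta\rrbracket^{\mathit{tr}}_{\mathcal{V}}\subseteq\mathbb{N}_0$ with $\mathit{ap}\mapsto\{i\mid\mathit{ap}\in\mathit{tr}(i)\}$, $Y\mapsto\mathcal{V}(Y)$, union, complement, $\bigcirc^\mathsf{f}\delta\mapsto\{i\mid\mathit{succ}_\mathsf{f}(\mathit{tr},i)$ defined and in $\llbracket\delta\rrbracket\}$, $\mu Y.\delta\mapsto\bigcap\{I\mid\llbracket\delta\rrbracket_{\mathcal{V}[Y\mapsto I]}\subseteq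 I\}$. $\mathit{succ}_\delta(\mathit{tr},i)=\min\{j>i\mid j\in\llbracket\delta\rrbracket^{\mathit{tr}}\}$ if nonempty else $i+1$; $\mathit{succ}_\Delta(\Pi,v)$ componentwise for a trace assignment $\Pi$ on $\pi_1,\dots,\pi_n$. $\llbracket\psi\rrbracket^\Pi_{\mathcal{W}}\subseteq\mathbb{N}_0^n$: $[\delta]_{\pi_j}\mapsto\{v\mid v_j\in\llbracket\delta\rrbracket^{\Pi(\pi_j)}\}$, $X\mapsto\mathcal{W}(X)$, Boolean as usual, $\bigcirc^\Delta\psi\mapsto\{v\mid\mathit{succ}_\Delta(\Pi,v)\in\llbracket\psi\rrbracket\}$, $\mu X$ least fixpoint. $\Pi\models_\mathcal{T}\exists\pi.\varphi$ iff some $\mathit{tr}\in\mathcal{T}$ gives $\Pi[\pi\mapsto\mathit{tr}]\models_\mathcal{T}\varphi$; $\forall$ for all; $\Pi\models_\mathcal{T}\psi$ iff $(0,\dots,0)\in\llbracket\psi\rrbracket^\Pi$. For closed $\varphi$, $\mathcal{T}\models\varphi$ iff the empty assignment satisfies $\varphi$. Unique mumbling: all next operators $\bigcirc^\Delta$ in $\varphi$ use the same $\Delta$. *)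

(* Defs.v *)
From Stdlib Require List.
From mathcomp Require Import all_boot.
Set Implicit Arguments. Unset Strict Implicit. Unset Printing Implicit Defensive.

Inductive prf : Type :=
| pzero : prf
| psucc : prf
| pproj : nat -> prf
| pcomp : prf -> list prf -> prf
| prec  : prf -> prf -> prf
| pmu   : prf -> prf.

Inductive peval : prf -> list nat -> nat -> Prop :=
| pe_zero xs : peval pzero xs 0
| pe_succ xs : peval psucc xs (head 0 xs).+1
| pe_proj i xs : peval (pproj i) xs (nth 0 xs i)
| pe_comp f gs xs ys y :
    pevals gs xs ys -> peval f ys y -> peval (pcomp f gs) xs y
| pe_rec0 f g xs y : peval f xs y -> peval (prec f g) (0 :: xs) y
| pe_recS f g n xs z y :
    peval (prec f g) (n :: xs) z -> peval g (n :: z :: xs) y ->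
    peval (prec f g) (n.+1 :: xs) y
| pe_mu f xs n :
    peval f (n :: xs) 0 ->
    (forall m, m < n -> exists k, peval f (m :: xs) k.+1) ->
    peval (pmu f) xs n
with pevals : list prf -> list nat -> list nat -> Prop :=
| pes_nil xs : pevals [::] xs [::]
| pes_cons g gs xs y ys :
    peval g xs y -> pevals gs xs ys -> pevals (g :: gs) xs (y :: ys).

Inductive mode : Type := MInt | MCall | MRet.

Definition is_call (m : mode) : bool := if m is MCall then true else false.
Definition is_ret (m : mode) : bool := if m is MRet then true else false.

(* a trace P_0 m_0 P_1 m_1 ... ; atomic propositions are natural numbers *)
Record trace : Type := Trace { tlab : nat -> nat -> bool ; tmode : nat -> mode }.

Definition default_trace : trace := Trace (fun _ _ => false) (fun _ => MInt).

Definition cntm (p : mode -> bool) (tr : trace) (a b : nat) : nat :=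
  count p (map (tmode tr) (iota a (b - a))).

Definition balanced (tr : trace) (a b : nat) : Prop :=
  cntm is_call tr a b = cntm is_ret tr a b.

Inductive succ_kind : Type := Sg | Sa | Sc.

Definition succ_rel (f : succ_kind) (tr : trace) (i j : nat) : Prop :=
  match f with
  | Sg => j = i.+1
  | Sa => (tmode tr i = MInt /\ j = i.+1) \/
          (tmode tr i = MCall /\ i < j /\ balanced tr i j /\
           forall j', i < j' < j -> ~ balanced tr i j')
  | Sc => j < i /\ tmode tr j = MCall /\ balanced tr j.+1 i /\
          forall j', j < j' < i -> tmode tr j' = MCall -> ~ balanced tr j'.+1 i
  end.

Inductive tform : Type :=
| TAp : nat -> tform
| TVar : nat -> tform
| TOr : tform -> tform -> tform
| TNeg : tform -> tform
| TNext : succ_kind -> tform -> tform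
| TMu : nat -> tform -> tform.

(* Delta : finite map from trace variables to trace formulae *)
Definition mumbling := seq (nat * tform).

Fixpoint lookupD (D : mumbling) (pi : nat) : option tform :=
  match D with
  | [::] => None
  | (p, d) :: D' => if p == pi then Some d else lookupD D' pi
  end.

Inductive mform : Type :=
| MAt : tform -> nat -> mform
| MVar : nat -> mform
| MOr : mform -> mform -> mform
| MNeg : mform -> mform
| MNext : mumbling -> mform -> mform
| MMu : nat -> mform -> mform.

Inductive hform : Type :=
| HEx : nat -> hform -> hform
| HAll : nat -> hform -> hform
| HM : mform -> hform.

Definition updV (A : Type) (V : nat -> A) (y : nat) (a : A) : nat -> A :=
  fun y' => if y' == y then a else V y'.

Fixpoint tsem (tr : trace) (V : nat -> nat -> Prop) (d : tform) : nat -> Prop :=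
  match d with
  | TAp a => fun i => tlab tr i a
  | TVar y => V y
  | TOr d1 d2 => fun i => tsem tr V d1 i \/ tsem tr V d2 i
  | TNeg d1 => fun i => ~ tsem tr V d1 i
  | TNext f d1 => fun i => exists j, succ_rel f tr i j /\ tsem tr V d1 j
  | TMu y d1 => fun i =>
      forall I : nat -> Prop, (forall j, tsem tr (updV V y I) d1 j -> I j) -> I i
  end.

Definition V0 : nat -> nat -> Prop := fun _ _ => False.

Definition succ_delta (tr : trace) (d : tform) (i j : nat) : Prop :=
  let S := tsem tr V0 d in
  (S j /\ i < j /\ forall j', i < j' < j -> ~ S j') \/
  ((forall j', i < j' -> ~ S j') /\ j = i.+1).

(* position vectors: one position per trace variable *)
Definition vec := nat -> nat.

(* succ_Delta(Pi, v) = w (componentwise; variables outside the domain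
   of Delta are left unchanged -- never relevant for well-formed inputs) *)
Definition succ_Delta (Pi : nat -> trace) (D : mumbling) (v w : vec) : Prop :=
  forall pi, match lookupD D pi with
             | Some d => succ_delta (Pi pi) d (v pi) (w pi)
             | None => w pi = v pi
             end.

Fixpoint msem (Pi : nat -> trace) (W : nat -> vec -> Prop) (p : mform) : vec -> Prop :=
  match p with
  | MAt d pi => fun v => tsem (Pi pi) V0 d (v pi)
  | MVar x => W x
  | MOr p1 p2 => fun v => msem Pi W p1 v \/ msem Pi W p2 v
  | MNeg p1 => fun v => ~ msem Pi W p1 v
  | MNext D p1 => fun v => exists w, succ_Delta Pi D v w /\ msem Pi W p1 w
  | MMu x p1 => fun v =>
      forall I : vec -> Prop, (forall w, msem Pi (updV W x I) p1 w -> I w) -> I v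
  end.

Definition W0 : nat -> vec -> Prop := fun _ _ => False.

Fixpoint hsat (T : trace -> Prop) (Pi : nat -> trace) (phi : hform) : Prop :=
  match phi with
  | HEx pi phi1 => exists tr, T tr /\ hsat T (updV Pi pi tr) phi1
  | HAll pi phi1 => forall tr, T tr -> hsat T (updV Pi pi tr) phi1
  | HM p => msem Pi W0 p (fun _ => 0)
  end.

(* T |= phi  (empty trace assignment; the default trace is never read
   for closed phi) *)
Definition hmodels (T : trace -> Prop) (phi : hform) : Prop :=
  hsat T (fun _ => default_trace) phi.

(* States and stack symbols are natural numbers; S is {0..N} for any N
   bounding the states mentioned; Theta is the set of stack symbols
   mentioned; the bottom symbol is the empty stack. *)
Record pds : Type := PDS {
  pd_init : seq nat;
  pd_int  : seq (nat * nat);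
  pd_call : seq (nat * nat * nat);   (* (s, s', theta) *)
  pd_ret  : seq (nat * nat * nat);   (* (s, theta, s') *)
  pd_lab  : seq (seq nat)            (* L(s) = atoms < k in nth [::] pd_lab s *)
}.

Definition pd_L (k : nat) (pd : pds) (s : nat) (a : nat) : bool :=
  (a < k) && (a \in nth [::] (pd_lab pd) s).

Definition pd_step (pd : pds) (s : nat) (u : seq nat) (m : mode)
    (s' : nat) (u' : seq nat) : Prop :=
  match m with
  | MInt => (s, s') \in pd_int pd /\ u' = u
  | MCall => exists th, (s, s', th) \in pd_call pd /\ u' = th :: u
  | MRet => exists th u0, u = th :: u0 /\ (s, th, s') \in pd_ret pd /\ u' = u0
  end.

Definition pd_trace (k : nat) (pd : pds) (tr : trace) : Prop :=
  exists (st : nat -> nat) (stk : nat -> seq nat),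
    st 0 \in pd_init pd /\ stk 0 = [::] /\
    (forall i, pd_step pd (st i) (stk i) (tmode tr i) (st i.+1) (stk i.+1)) /\
    (forall i a, tlab tr i a = pd_L k pd (st i) a).

Fixpoint tpos (y : nat) (pol : bool) (d : tform) : bool :=
  match d with
  | TAp _ => true
  | TVar y' => (y' != y) || pol
  | TOr d1 d2 => tpos y pol d1 && tpos y pol d2
  | TNeg d1 => tpos y (~~ pol) d1
  | TNext _ d1 => tpos y pol d1
  | TMu y' d1 => (y' == y) || tpos y pol d1
  end.

Fixpoint t_ok (k : nat) (B : seq nat) (d : tform) : bool :=
  match d with
  | TAp a => a < k
  | TVar y => y \in B
  | TOr d1 d2 => t_ok k B d1 && t_ok k B d2
  | TNeg d1 => t_ok k B d1
  | TNext _ d1 => t_ok k B d1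
  | TMu y d1 => t_ok k (y :: B) d1 && tpos y true d1
  end.

Fixpoint mpos (x : nat) (pol : bool) (p : mform) : bool :=
  match p with
  | MAt _ _ => true
  | MVar x' => (x' != x) || pol
  | MOr p1 p2 => mpos x pol p1 && mpos x pol p2
  | MNeg p1 => mpos x (~~ pol) p1
  | MNext _ p1 => mpos x pol p1
  | MMu x' p1 => (x' == x) || mpos x pol p1
  end.

Fixpoint m_ok (k : nat) (TV B : seq nat) (p : mform) : bool :=
  match p with
  | MAt d pi => t_ok k [::] d && (pi \in TV)
  | MVar x => x \in B
  | MOr p1 p2 => m_ok k TV B p1 && m_ok k TV B p2
  | MNeg p1 => m_ok k TV B p1
  | MNext D p1 =>
      all (fun pi => if lookupD D pi is Some _ then true else false) TV &&
      all (fun e => t_ok k [::] e.2) D && m_ok k TV B p1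
  | MMu x p1 => m_ok k TV (x :: B) p1 && mpos x true p1
  end.

Fixpoint h_ok (k : nat) (TV : seq nat) (phi : hform) : bool :=
  match phi with
  | HEx pi phi1 => h_ok k (pi :: TV) phi1
  | HAll pi phi1 => h_ok k (pi :: TV) phi1
  | HM p => m_ok k TV [::] p
  end.

Fixpoint m_Deltas (p : mform) : seq mumbling :=
  match p with
  | MAt _ _ | MVar _ => [::]
  | MOr p1 p2 => m_Deltas p1 ++ m_Deltas p2
  | MNeg p1 => m_Deltas p1
  | MNext D p1 => D :: m_Deltas p1
  | MMu _ p1 => m_Deltas p1
  end.

Fixpoint h_Deltas (phi : hform) : seq mumbling :=
  match phi with
  | HEx _ phi1 | HAll _ phi1 => h_Deltas phi1
  | HM p => m_Deltas p
  end.

Definition unique_mumbling (phi : hform) : Prop :=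
  forall D1 D2, List.In D1 (h_Deltas phi) -> List.In D2 (h_Deltas phi) ->
    forall pi, lookupD D1 pi = lookupD D2 pi.

Definition wf_input (k : nat) (phi : hform) : Prop :=
  h_ok k [::] phi /\ unique_mumbling phi.

Definition kind_code (f : succ_kind) : nat :=
  match f with Sg => 0 | Sa => 1 | Sc => 2 end.

Fixpoint t_tree (d : tform) : GenTree.tree nat :=
  match d with
  | TAp a => GenTree.Node 0 [:: GenTree.Leaf a]
  | TVar y => GenTree.Node 1 [:: GenTree.Leaf y]
  | TOr d1 d2 => GenTree.Node 2 [:: t_tree d1; t_tree d2]
  | TNeg d1 => GenTree.Node 3 [:: t_tree d1]
  | TNext f d1 => GenTree.Node 4 [:: GenTree.Leaf (kind_code f); t_tree d1]
  | TMu y d1 => GenTree.Node 5 [:: GenTree.Leaf y; t_tree d1]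
  end.

Definition D_tree (D : mumbling) : GenTree.tree nat :=
  GenTree.Node 0 [seq GenTree.Node 0 [:: GenTree.Leaf e.1; t_tree e.2] | e <- D].

Fixpoint m_tree (p : mform) : GenTree.tree nat :=
  match p with
  | MAt d pi => GenTree.Node 0 [:: t_tree d; GenTree.Leaf pi]
  | MVar x => GenTree.Node 1 [:: GenTree.Leaf x]
  | MOr p1 p2 => GenTree.Node 2 [:: m_tree p1; m_tree p2]
  | MNeg p1 => GenTree.Node 3 [:: m_tree p1]
  | MNext D p1 => GenTree.Node 4 [:: D_tree D; m_tree p1]
  | MMu x p1 => GenTree.Node 5 [:: GenTree.Leaf x; m_tree p1]
  end.

Fixpoint h_tree (phi : hform) : GenTree.tree nat :=
  match phi with
  | HEx pi phi1 => GenTree.Node 0 [:: GenTree.Leaf pi; h_tree phi1]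
  | HAll pi phi1 => GenTree.Node 1 [:: GenTree.Leaf pi; h_tree phi1]
  | HM p => GenTree.Node 2 [:: m_tree p]
  end.

Definition nats_tree (s : seq nat) : GenTree.tree nat :=
  GenTree.Node 0 [seq GenTree.Leaf a | a <- s].

Definition pd_tree (pd : pds) : GenTree.tree nat :=
  GenTree.Node 0
    [:: nats_tree (pd_init pd);
        GenTree.Node 0 [seq nats_tree [:: e.1; e.2] | e <- pd_int pd];
        GenTree.Node 0 [seq nats_tree [:: e.1.1; e.1.2; e.2] | e <- pd_call pd];
        GenTree.Node 0 [seq nats_tree [:: e.1.1; e.1.2; e.2] | e <- pd_ret pd];
        GenTree.Node 0 [seq nats_tree s | s <- pd_lab pd]].

Definition encode_input (pd : pds) (phi : hform) : nat :=
  pickle (GenTree.Node 0 [:: pd_tree pd; h_tree phi]).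

Definition decides_mc (k : nat) (f : prf) : Prop :=
  forall (pd : pds) (phi : hform), wf_input k phi ->
    (hmodels (pd_trace k pd) phi -> peval f [:: encode_input pd phi] 1) /\
    (~ hmodels (pd_trace k pd) phi -> peval f [:: encode_input pd phi] 0).

(* Main.v *)
(* Idea: suppose [f] decides the problem.  A register machine is simulated by
   one trace per register, run in lockstep by an existentially quantified
   formula whose unique mumbling is the ordinary successor: the stack of each
   trace holds one register above a bottom marker, the outcome of a zero test
   is guessed by every trace and known to the trace of the tested register, and
   agreement on one atomic proposition forces the guesses to be right.

   The initial value of register 0 enters the formula only as a tower of next
   operators placed at its very end.  Since [CodeSeq.code] concatenates bit
   strings, the code of the whole input is a computable function of that value
   [x], of the number of registers, and of the code of the part preceding the
   tower, which does not depend on [x].  Taking this last code as [x] lets the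
   machine compute the code of its own instance, run [f] on it, and accept
   exactly when [f] rejects. *)
From Stdlib Require List.
From Stdlib Require Import Classical ClassicalEpsilon FunctionalExtensionality.
From mathcomp Require Import all_boot zify.
Require Import Defs.
Set Implicit Arguments. Unset Strict Implicit. Unset Printing Implicit Defensive.

(** * Computing codes of sequences *)

Lemma pevals2 g h xs y z :
  peval g xs y -> peval h xs z -> pevals [:: g; h] xs [:: y; z].
Proof. by move=> Hg Hh; do 2!constructor=> //; constructor. Qed.

Lemma peval_comp1 f g xs y z :
  peval g xs y -> peval f [:: y] z -> peval (pcomp f [:: g]) xs z.
Proof. by move=> Hg Hf; apply: pe_comp Hf; constructor=> //; constructor. Qed.

Lemma peval_comp2 f g h xs y z w :
  peval g xs y -> peval h xs z -> peval f [:: y; z] w ->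
  peval (pcomp f [:: g; h]) xs w.
Proof. by move=> Hg Hh Hf; apply: pe_comp Hf; apply: pevals2. Qed.

Definition pconst (c : nat) : prf := iter c (fun p => pcomp psucc [:: p]) pzero.

Lemma peval_const c xs : peval (pconst c) xs c.
Proof.
elim: c => [|c IHc]; first by constructor.
exact: peval_comp1 IHc (pe_succ [:: c]).
Qed.

Lemma peval_proj i xs y : nth 0 xs i = y -> peval (pproj i) xs y.
Proof. by move=> <-; constructor. Qed.

Definition piter (p : prf) : prf := prec (pproj 0) (pcomp p [:: pproj 1]).

Lemma peval_iter p F :
  (forall m, peval p [:: m] (F m)) ->
  forall n m, peval (piter p) [:: n; m] (iter n F m).
Proof.
move=> Hp; elim=> [|n IHn] m; first by constructor; apply: peval_proj.
by apply: pe_recS (IHn m) _; apply: peval_comp1 (Hp _); apply: peval_proj.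
Qed.

Definition pdbl : prf := prec pzero (pcomp psucc [:: pcomp psucc [:: pproj 1]]).

Lemma peval_dbl n : peval pdbl [:: n] n.*2.
Proof.
elim: n => [|n IHn]; first by do 2!constructor.
apply: pe_recS IHn _; apply: peval_comp1 (pe_succ [:: n.*2.+1]).
by apply: peval_comp1 (pe_succ [:: n.*2]); apply: peval_proj.
Qed.

Lemma iter_double j m : iter j double m = 2 ^ j * m.
Proof. by elim: j => [|j IHj] /=; rewrite ?mul1n // IHj expnS -mul2n mulnA. Qed.

Definition ppred : prf := prec pzero (pproj 0).

Lemma peval_pred n : peval ppred [:: n] n.-1.
Proof.
elim: n => [|n IHn]; first by do 2!constructor.
by apply: pe_recS IHn _; apply: peval_proj.
Qed.

(* [CodeSeq.code] prepends an entry [c] to a list of code [m] by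
   [m |-> 2 ^ c * (2 m + 1)]; [prepend ns] iterates this. *)
Definition prepend (ns : seq nat) (m : nat) : nat :=
  foldr (fun c m => 2 ^ c * m.*2.+1) m ns.

Lemma code_cat s1 s2 : CodeSeq.code (s1 ++ s2) = prepend s1 (CodeSeq.code s2).
Proof. exact: foldr_cat. Qed.

Lemma code_nseq_cat ns j s :
  CodeSeq.code (flatten (nseq j ns) ++ s) = iter j (prepend ns) (CodeSeq.code s).
Proof. by elim: j => //= j IHj; rewrite -catA code_cat IHj. Qed.

Definition pprepend (ns : seq nat) : prf :=
  foldr (fun c p => pcomp (iter c (fun q => pcomp pdbl [:: q]) (pcomp psucc [:: pdbl]))
                          [:: p]) (pproj 0) ns.

Lemma peval_prepend ns m : peval (pprepend ns) [:: m] (prepend ns m).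
Proof.
elim: ns => [|c ns IHns]; first exact: peval_proj.
apply: peval_comp1 IHns _; rewrite [prepend (c :: ns) m]/= -/(prepend ns m) -iter_double.
move: (prepend ns m) => {}m; elim: c => [|c IHc].
  exact: peval_comp1 (peval_dbl m) (pe_succ [:: m.*2]).
exact: peval_comp1 IHc (peval_dbl _).
Qed.

Definition ppow2 : prf := pcomp (piter pdbl) [:: pproj 0; pconst 1].

Lemma peval_pow2 j xs : peval ppow2 (j :: xs) (2 ^ j).
Proof.
apply: peval_comp2 (peval_proj _) (peval_const 1 _) _; first by [].
by rewrite -[2 ^ j]muln1 -iter_double; apply: peval_iter peval_dbl _ _.
Qed.

(* [pbitlen] finds the least [j] with [x < 2 ^ j] as the least zero of
   [(x + 1) - 2 ^ j]. *)
Definition pbitlen : prf :=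
  pmu (pcomp (piter ppred) [:: ppow2; pcomp psucc [:: pproj 1]]).

Lemma peval_bitlen x xs L :
  (forall j, (x < 2 ^ j) = (L <= j)) -> peval pbitlen (x :: xs) L.
Proof.
move=> HL.
have Hstep j : peval (pcomp (piter ppred) [:: ppow2; pcomp psucc [:: pproj 1]])
                     (j :: x :: xs) (x.+1 - 2 ^ j).
  apply: peval_comp2 (peval_pow2 j _) _ _.
    by apply: peval_comp1 (pe_succ [:: x]); apply: peval_proj.
  have -> : x.+1 - 2 ^ j = iter (2 ^ j) predn x.+1.
    by elim: (2 ^ j) => [|i IHi] /=; rewrite ?subn0 // subnS IHi.
  exact: peval_iter peval_pred _ _.
constructor=> [|j ltjL].
  by have := Hstep L; rewrite (eqP (_ : x.+1 - 2 ^ L == 0)) // subn_eq0 HL.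
(* Below [L] the power [2 ^ j] is at most [x], so the truncated difference is a successor, as
   [pe_mu] requires. *)
exists (x - 2 ^ j); rewrite -subSn //.
by rewrite leqNgt HL -ltnNge.
Qed.

(** Prepending an entry takes [m] to at least [2 m + 1]. This later makes the loaded value exceed
    the number of registers. *)
Lemma size_le_code s : size s <= CodeSeq.code s.
Proof.
elim: s => //= n s IHs; apply: leq_ltn_trans IHs _.
have := expn_gt0 2 n; nia.
Qed.

(* In base 2 (least bit first), [CodeSeq.code] writes an entry [n] as [n]
   zeros followed by a one: coding a concatenation concatenates bit strings. *)
Lemma code_cat_bitlen s : s != [::] ->
  exists L, (forall j, (CodeSeq.code s < 2 ^ j) = (L <= j)) /\
    forall t, CodeSeq.code (s ++ t) = CodeSeq.code s + 2 ^ L * CodeSeq.code t.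
Proof.
(* The induction carries both bounds that make [L] the exact bit length; the lower one fails for the
   empty list, whose code is 0. *)
suff H : exists L, (if s is [::] then L = 0 else 2 ^ L <= (CodeSeq.code s).*2) /\
    CodeSeq.code s < 2 ^ L /\
    forall t, CodeSeq.code (s ++ t) = CodeSeq.code s + 2 ^ L * CodeSeq.code t.
  move=> s0; have [L [HL [ltL Hcat]]] := H.
  have {}HL : 2 ^ L <= (CodeSeq.code s).*2 by case: (s) s0 HL.
  exists L; split=> // j; apply/idP/idP=> [ltj | leLj].
    rewrite leqNgt -ltnS; apply/negP=> ltjL.
    have : 2 ^ j.+1 <= 2 ^ L by rewrite leq_exp2l.
    by rewrite expnS; lia.
  by apply: leq_trans ltL _; rewrite leq_exp2l.
elim: s => [|n s [L [HL [ltL Hcat]]]].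
  by exists 0; split=> //; split=> // t; rewrite expn0 mul1n.
have HL' : 2 ^ L <= (CodeSeq.code s).*2.+1.
  by case: (s) HL => [-> //|c s' /leqW].
exists (n.+1 + L); rewrite /= -/(CodeSeq.code s) expnD expnS.
move: (CodeSeq.code s) (2 ^ L) (2 ^ n) (expn_gt0 2 n) HL' ltL Hcat => q a b.
rewrite -!muln2 => pos H1 H2 Hcat; split; first by nia.
by split=> [|t]; [nia | rewrite -/(CodeSeq.code _) Hcat; nia].
Qed.

(** * Register programs for partial recursive functions *)

Lemma updVE (A : Type) (V : nat -> A) y a z :
  updV V y a z = if z == y then a else V z.
Proof. by []. Qed.

(** [CLoop r c] tests and decrements [r] before each pass, so that its head becomes a single [IJzd]
    instruction. *)
Inductive cmd : Type :=
| CInc : nat -> cmd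
| CDec : nat -> cmd
| CSeq : cmd -> cmd -> cmd
| CLoop : nat -> cmd -> cmd.

Inductive exec : cmd -> (nat -> nat) -> (nat -> nat) -> Prop :=
| ex_inc r s : exec (CInc r) s (updV s r (s r).+1)
| ex_dec0 r s : s r = 0 -> exec (CDec r) s s
| ex_decS r s : s r <> 0 -> exec (CDec r) s (updV s r (s r).-1)
| ex_seq c d s s1 s2 : exec c s s1 -> exec d s1 s2 -> exec (CSeq c d) s s2
| ex_loop0 r c s : s r = 0 -> exec (CLoop r c) s s
| ex_loopS r c s s1 s2 : s r <> 0 -> exec c (updV s r (s r).-1) s1 ->
    exec (CLoop r c) s1 s2 -> exec (CLoop r c) s s2.

(* [I j s]: [s] is reachable at the loop head with [j] iterations left. *)
Lemma exec_loop r c (I : nat -> (nat -> nat) -> Prop) n s :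
  I n s ->
  (forall j s, j <= n -> I j s -> s r = j) ->
  (forall j s, j < n -> I j.+1 s ->
     exists s', exec c (updV s r j) s' /\ I j s') ->
  exists s', exec (CLoop r c) s s' /\ I 0 s'.
Proof.
move=> Is Ir Istep; elim: n s Is Ir Istep => [|n IHn] s Is Ir Istep.
  by exists s; split=> //; apply: ex_loop0; apply: (Ir 0).
have rE := Ir _ _ (leqnn _) Is.
have [s1 [ex1 I1]] := Istep n s (leqnn _) Is.
have [||s2 [ex2 I2]] := IHn s1 I1.
- by move=> j t jn; apply: Ir; apply: leqW.
- by move=> j t jn; apply: Istep; apply: leqW.
by exists s2; split=> //; apply: ex_loopS ex2; rewrite rE.
Qed.

(** As there is no empty command, the loop body is a second decrement, harmless at zero; a pass may
    thus lower [r] by two. *)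
Definition CClear (r : nat) : cmd := CLoop r (CDec r).

Lemma exec_clear r s :
  exists s', exec (CClear r) s s' /\ s' r = 0 /\ forall q, q != r -> s' q = s q.
Proof.
have [k] := ubnP (s r); elim: k s => // k IHk s ltk.
case: (posnP (s r)) => [r0|rpos]; first by exists s; split=> //; apply: ex_loop0.
have rn0 : s r <> 0 by lia.
case: (posnP (s r).-1) => [r1|r1].
  exists (updV s r 0); split; last first.
    by split=> [|q /negPf qr]; rewrite updVE ?eqxx ?qr.
  apply: ex_loopS rn0 _ (ex_loop0 _ _); last by rewrite updVE eqxx.
  by rewrite r1; apply: ex_dec0; rewrite updVE eqxx.
pose t := updV s r (s r).-1; pose t' := updV t r (t r).-1.
have tr : t r = (s r).-1 by rewrite /t updVE eqxx.
have [|s' [ex' [r' q']]] := IHk t'; first by rewrite /t' updVE eqxx tr; lia.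
exists s'; split.
  by apply: ex_loopS rn0 _ ex'; apply: ex_decS; rewrite -/t tr; lia.
by split=> // q qr; rewrite q' // /t' /t !updVE (negPf qr).
Qed.

(** Reading a register by a loop destroys it: [r] is drained into both [o] and [t], then restored
    from [t]. *)
Definition CCopy (r o t : nat) : cmd :=
  CSeq (CClear o) (CSeq (CClear t)
    (CSeq (CLoop r (CSeq (CInc o) (CInc t))) (CLoop t (CInc r)))).

Lemma exec_copy r o t s : r != o -> r != t -> o != t ->
  exists s', exec (CCopy r o t) s s' /\ s' o = s r /\
    forall q, q != o -> q != t -> s' q = s q.
Proof.
move=> ro rt ot; have [or' [tr' to']] : o != r /\ t != r /\ t != o.
  by rewrite !(eq_sym t) eq_sym.
pose ne := (negPf ro, negPf rt, negPf ot, negPf or', negPf tr', negPf to').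
have [s1 [ex1 [o1 q1]]] := exec_clear o s.
have [s2 [ex2 [t2 q2]]] := exec_clear t s1.
have [|||s3 [ex3 [r3 [o3 [t3 q3]]]]] := @exec_loop r (CSeq (CInc o) (CInc t))
  (fun j u => u r = j /\ u o = s r - j /\ u t = s r - j /\
     forall q, q != r -> q != o -> q != t -> u q = s q) (s r) s2 _ _ _.
- split; first by rewrite q2 // q1.
  rewrite subnn q2 ?o1 //; do 2!split=> //.
  by move=> q _ qo qt; rewrite q2 // q1.
- by move=> j u _ [].
- move=> j u jn [ur [uo [ut uq]]]; eexists; split.
    by apply: ex_seq; apply: ex_inc.
  rewrite !updVE !(eqxx, ne) uo ut.
  split=> //; split; first by lia.
  split; first by lia.
  move=> q qr qo qt.
  by rewrite !updVE (negPf qr) (negPf qo) (negPf qt) uq.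
have [|||s4 [ex4 [r4 [t4 q4]]]] := @exec_loop t (CInc r)
  (fun j u => u r = s r - j /\ u t = j /\
     forall q, q != r -> q != t -> u q = s3 q) (s r) s3 _ _ _.
- by rewrite r3 t3 subnn subn0.
- by move=> j u _ [_ []].
- move=> j u jn [ur [ut uq]]; eexists; split; first exact: ex_inc.
  rewrite !updVE !(eqxx, ne) ur.
  split; first by lia.
  by split=> // q qr qt; rewrite !updVE (negPf qr) (negPf qt) uq.
exists s4; split; first by do ![apply: ex_seq; first by eauto].
rewrite q4 1?eq_sym // o3 subn0; split=> // q qo qt.
have [->|qr] := eqVneq q r; first by rewrite r4 subn0.
by rewrite q4 // q3.
Qed.

(** Clearing [o] for an index out of range matches the default 0 in [pe_proj] and [pe_succ]. *)
Definition CLoad (rs : seq nat) (i o t : nat) : cmd :=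
  if i < size rs then CCopy (nth 0 rs i) o t else CClear o.

Lemma exec_load rs i o t s : o < t -> o \notin rs -> all (ltn^~ t) rs ->
  exists s', exec (CLoad rs i o t) s s' /\ s' o = nth 0 (map s rs) i /\
    forall q, q < t -> q != o -> s' q = s q.
Proof.
move=> ot ors /allP rst; rewrite /CLoad; case: ltnP => irs.
  have inrs : nth 0 rs i \in rs by apply: mem_nth.
  have ltt := rst _ inrs.
  have [|||s' [ex' [o' q']]] := @exec_copy (nth 0 rs i) o t s _ _ _.
  - by apply: contraNneq ors => <-.
  - by move: ltt => /=; lia.
  - by lia.
  exists s'; split=> //; rewrite (nth_map 0) //; split=> // q qt qo.
  by rewrite q' //; lia.
have [s' [ex' [o' q']]] := exec_clear o s; exists s'; split=> //.
by rewrite nth_default ?size_map //; split=> // q _; apply: q'.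
Qed.

(** [C] stays outside the inner fixpoint so that the nested recursion of [compile] is accepted as
    structural. The final clearing of [o] stands in for an empty command. *)
Definition store_all (C : prf -> nat -> cmd) (o : nat) :=
  fix store (gs : seq prf) (j : nat) : cmd :=
    if gs is g :: gs' then CSeq (C g j) (store gs' j.+1) else CClear o.

(* [compile p rs o b] computes [p] on the contents of the registers [rs] into
   [o], using the registers from [b] on as scratch space. *)
Fixpoint compile (p : prf) (rs : seq nat) (o b : nat) : cmd :=
  match p with
  | pzero => CClear o
  | psucc => CSeq (CLoad rs 0 o b) (CInc o)
  | pproj i => CLoad rs i o b
  | pcomp f gs =>
      let m := size gs in
      CSeq (store_all (fun g j => compile g rs j (b + m)) o gs b)
           (compile f (iota b m) o (b + m))
  | prec f g =>
      if rs is r :: rs' then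
        CSeq (compile f rs' b.+2 (b + 4))
       (CSeq (CClear b.+1)
       (CSeq (CCopy r b (b + 4))
       (CSeq (CLoop b (CSeq (compile g (b.+1 :: b.+2 :: rs') b.+3 (b + 4))
                      (CSeq (CCopy b.+3 b.+2 (b + 4)) (CInc b.+1))))
             (CCopy b.+2 o (b + 4)))))
      else CClear o
  | pmu f =>
      CSeq (CClear b)
     (CSeq (compile f (b :: rs) b.+1 b.+2)
     (CSeq (CLoop b.+1 (CSeq (CInc b) (compile f (b :: rs) b.+1 b.+2)))
           (CCopy b o b.+2)))
  end.

(** The frame clause, with [o] outside [rs], keeps the inputs intact, so that several programs can
    read them in turn. *)
Definition compile_correct (p : prf) : Prop :=
  forall rs o b s xs y, peval p xs y -> map s rs = xs ->
    o < b -> o \notin rs -> all (ltn^~ b) rs ->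
    exists s', exec (compile p rs o b) s s' /\ s' o = y /\
      forall q, q < b -> q != o -> s' q = s q.

(** The generated principle gives no hypothesis for the list of subterms in [pcomp]. *)
Lemma prf_list_ind (P : prf -> Prop) :
  P pzero -> P psucc -> (forall i, P (pproj i)) ->
  (forall f gs, P f -> List.Forall P gs -> P (pcomp f gs)) ->
  (forall f g, P f -> P g -> P (prec f g)) ->
  (forall f, P f -> P (pmu f)) ->
  forall p, P p.
Proof.
move=> H0 HS Hp Hc Hr Hm; fix IH 1; case=> [||i|f gs|f g|f].
- exact: H0.
- exact: HS.
- exact: Hp.
- apply: Hc; first exact: IH.
  elim: gs => [|g gs IHgs]; first exact: List.Forall_nil.
  by apply: List.Forall_cons; [apply: IH | apply: IHgs].
- by apply: Hr; apply: IH.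
- by apply: Hm; apply: IH.
Qed.

Lemma all_ltn_trans b b' rs : b <= b' -> all (ltn^~ b) rs -> all (ltn^~ b') rs.
Proof. by move=> bb'; apply: sub_all => q /= /leq_trans; apply. Qed.

Lemma notin_below b o rs : b <= o -> all (ltn^~ b) rs -> o \notin rs.
Proof. by move=> bo /allP H; apply/negP=> /H /=; lia. Qed.

(** The targets lie between [b] and the scratch space at [b'], so later computations preserve both
    the inputs and the values already stored. *)
Lemma store_all_correct gs rs o b b' xs ys j s :
  List.Forall compile_correct gs -> pevals gs xs ys -> map s rs = xs ->
  o < b -> all (ltn^~ b) rs -> b <= j -> j + size gs <= b' ->
  exists s', exec (store_all (fun g i => compile g rs i b') o gs j) s s' /\
    map s' (iota j (size gs)) = ys /\
    forall q, q < j -> q != o -> s' q = s q.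
Proof.
move=> Hgs Hev rsE ob rsb.
elim: Hgs ys j s Hev rsE => {gs} [|g gs Hg _ IH] ys j s Hev rsE bj jb'.
  inversion Hev; subst; have [s' [ex' [_ q']]] := exec_clear o s.
  by exists s'; split=> //; split=> // q _; apply: q'.
inversion Hev as [|? ? ? y ys' Hgy Hgs']; subst.
have [|||s1 [ex1 [y1 q1]]] := Hg rs j b' s _ _ Hgy erefl.
- by move: jb' => /=; lia.
- exact: notin_below bj rsb.
- by apply: all_ltn_trans rsb; move: jb' => /=; lia.
have q1' q : q < b -> s1 q = s q.
  by move=> qb; apply: q1; [move: jb' => /= | ]; lia.
have [|||s2 [ex2 [m2 q2]]] := IH ys' j.+1 s1 Hgs'.
- by apply/eq_in_map => q /(allP rsb)/q1'.
- exact: leqW.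
- by move: jb' => /=; lia.
exists s2; split; first exact: ex_seq ex1 ex2.
split; first by rewrite /= m2 q2 ?y1 //; lia.
move=> q qj qo; rewrite q2 //; last exact: leqW.
by apply: q1; move: jb' => /=; lia.
Qed.

Lemma compile_comp f gs : compile_correct f -> List.Forall compile_correct gs ->
  compile_correct (pcomp f gs).
Proof.
move=> IHf IHgs rs o b s xs y ev; inversion ev as [| | |? ? ? ys ? Hgs Hf| | |].
subst=> sE ob ors rsb /=.
have [s1 [ex1 [m1 q1]]] := store_all_correct IHgs Hgs sE ob rsb (leqnn _) (leqnn _).
have [|||s2 [ex2 [y2 q2]]] := IHf (iota b (size gs)) o (b + size gs) s1 _ _ Hf m1.
- exact: ltn_addr.
- by rewrite mem_iota leqNgt ob.
- by apply/allP => q; rewrite mem_iota => /andP[].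
exists s2; split; first exact: ex_seq ex1 ex2.
by split=> // q qb qo; rewrite q2 ?q1 // ltn_addr.
Qed.

(** Collects the intermediate values of the recursion into one function, to which a loop invariant
    can refer. *)
Lemma peval_rec_inv f g n xs y : peval (prec f g) (n :: xs) y ->
  exists z, z n = y /\ peval f xs (z 0) /\
    forall i, i < n -> peval g [:: i, z i & xs] (z i.+1).
Proof.
elim: n y => [|n IHn] y ev.
  by inversion ev; exists (fun _ => y).
inversion ev as [| | | | |? ? ? ? z0 ? Hn Hg|]; subst.
have [z [zn [z0E zS]]] := IHn _ Hn.
exists (fun i => if i <= n then z i else y); rewrite ltnn; split=> //; split=> // i.
rewrite ltnS => lein; rewrite lein; case: ltnP => [/zS //|leni].
by have -> : i = n; [lia | rewrite zn].
Qed.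

(** Register [b] counts the passes left, [b.+1] the index, [b.+2] holds the accumulated value and
    [b.+3] the next one. With [j] passes left the index is [s r - j]. *)
Lemma compile_rec f g : compile_correct f -> compile_correct g ->
  compile_correct (prec f g).
Proof.
move=> IHf IHg rs o b s xs y ev; case: rs => [|r rs] sE ob; subst xs.
  by inversion ev.
rewrite inE negb_or => /andP[or ors] /= /andP[rb rsb].
have [z [zn [z0 zS]]] := peval_rec_inv ev.
have [|||s1 [ex1 [y1 q1]]] := IHf rs b.+2 (b + 4) s _ _ z0 erefl; first lia.
- by apply: notin_below rsb; lia.
- by apply: all_ltn_trans rsb; lia.
have [s2 [ex2 [y2 q2]]] := exec_clear b.+1 s1.
have [|||s3 [ex3 [y3 q3]]] := @exec_copy r b (b + 4) s2; try lia.
have [|||s4 [ex4 [y4 [i4 [a4 q4]]]]] := @exec_loop b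
  (CSeq (compile g (b.+1 :: b.+2 :: rs) b.+3 (b + 4))
        (CSeq (CCopy b.+3 b.+2 (b + 4)) (CInc b.+1)))
  (fun j u => u b = j /\ u b.+1 = s r - j /\ u b.+2 = z (s r - j) /\
     forall q, q < b -> u q = s q) (s r) s3.
- rewrite subnn y3 !q3 ?y2 ?q2 ?y1 ?q1 //; try lia.
  by do 3!split=> //; move=> q qb; rewrite q3 ?q2 ?q1 //; lia.
- by move=> j u _ [].
- move=> j u jr [ub [ui [ua uq]]].
  have gE : peval g [:: s r - j.+1, z (s r - j.+1) & map s rs] (z (s r - j)).
    by have := zS (s r - j.+1); rewrite -subSn // subSS; apply; lia.
  have [||||u1 [ex1' [y1' q1']]] :=
    IHg (b.+1 :: b.+2 :: rs) b.+3 (b + 4) (updV u b j) _ _ gE.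
  + rewrite /= !updVE !ifN ?ui ?ua; try lia.
    do 2!congr (_ :: _); apply/eq_in_map => q /(allP rsb) /= qb.
    by rewrite updVE ifN ?uq //; lia.
  + lia.
  + rewrite !inE !negb_or (notin_below _ rsb); lia.
  + by rewrite /= (all_ltn_trans _ rsb); lia.
  have [|||u2 [ex2' [y2' q2']]] := @exec_copy b.+3 b.+2 (b + 4) u1; try lia.
  exists (updV u2 b.+1 (u2 b.+1).+1); split.
    by do ![apply: ex_seq; first by eauto]; apply: ex_inc.
  rewrite !updVE eqxx !ifN; try lia.
  rewrite y2' y1' !q2' ?q1'; try lia.
  rewrite !updVE eqxx !ifN ?ui; try lia.
  split=> //; split; first lia.
  split=> //.
  by move=> q qb; rewrite !updVE ifN ?q2' ?q1' ?updVE ?ifN ?uq; lia.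
have [|||s5 [ex5 [y5 q5]]] := @exec_copy b.+2 o (b + 4) s4; try lia.
exists s5; split; first by do ![apply: ex_seq; first by eauto].
rewrite y5 a4 subn0 zn; split=> // q qb qo.
by rewrite q5 ?q4 //; lia.
Qed.

(** The witnesses for the arguments below [y] are gathered into one function by induction on how
    many are covered. *)
Lemma peval_mu_inv f xs y : peval (pmu f) xs y ->
  exists v, v y = 0 /\ (forall i, i < y -> v i <> 0) /\
    forall i, i <= y -> peval f (i :: xs) (v i).
Proof.
move=> ev; inversion ev as [| | | | | |? ? ? ev0 evS]; subst.
suff: forall n, n <= y -> exists v : nat -> nat,
    forall i, i < n -> v i <> 0 /\ peval f (i :: xs) (v i).
  move=> /(_ y (leqnn y)) [v vE]; exists (fun i => if i < y then v i else 0).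
  rewrite ltnn; split=> //; split=> i iy; first by rewrite iy; case: (vE _ iy).
  by case: ltnP => [/vE [] //|yi]; have -> : i = y by lia.
elim=> [|n IHn] ny; first by exists (fun _ => 0).
have [v vE] := IHn (ltnW ny); have [k fk] := evS n ny.
exists (fun i => if i < n then v i else k.+1) => i; rewrite ltnS => lein.
by case: ltnP => [/vE //|leni]; have -> : i = n by lia.
Qed.

Lemma compile_mu f : compile_correct f -> compile_correct (pmu f).
Proof.
move=> IHf rs o b s xs y ev rsE ob ors rsb; subst xs.
have [v [vy [v0 vE]]] := peval_mu_inv ev.
have Hf i (u : nat -> nat) : i <= y -> u b = i ->
    (forall q, q < b -> u q = s q) ->
    exists u', exec (compile f (b :: rs) b.+1 b.+2) u u' /\ u' b.+1 = v i /\
      u' b = i /\ forall q, q < b -> u' q = s q.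
  move=> iy ub uq.
  have [||||u1 [ex1 [y1 q1]]] := IHf (b :: rs) b.+1 b.+2 u _ _ (vE i iy).
  - rewrite /= ub; congr (_ :: _); apply/eq_in_map => q /(allP rsb) /=.
    exact: uq.
  - by [].
  - by rewrite inE negb_or (notin_below _ rsb); lia.
  - by rewrite /= (all_ltn_trans _ rsb); lia.
  exists u1; split=> //; split=> //; rewrite q1; try lia; split=> // q qb.
  by rewrite q1 ?uq; lia.
(* The loop register holds a value of [f], not the number of passes left, so [exec_loop] does not
   fit; the induction is on the distance [d] from the candidate in [b] to the least zero. *)
have Hloop d (u : nat -> nat) : d <= y -> u b = y - d -> u b.+1 = v (y - d) ->
    (forall q, q < b -> u q = s q) ->
    exists u', exec (CLoop b.+1 (CSeq (CInc b) (compile f (b :: rs) b.+1 b.+2))) u u' /\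
      u' b = y /\ forall q, q < b -> u' q = s q.
  elim: d u => [|d IHd] u dy ub ut uq.
    rewrite subn0 in ub ut; exists u; split=> //.
    by apply: ex_loop0; rewrite ut.
  have utn0 : u b.+1 <> 0 by rewrite ut; apply: v0; lia.
  set t := updV u b.+1 (u b.+1).-1.
  have tb : t b = u b by rewrite /t updVE ifN //; lia.
  have [|||u1 [ex1 [y1 [b1 q1]]]] := Hf (y - d) (updV t b (t b).+1).
  - lia.
  - by rewrite updVE eqxx tb ub; lia.
  - by move=> q qb; rewrite /t !updVE !ifN ?uq //; lia.
  have [|||u2 [ex2 H2]] := IHd u1 (ltnW dy) => //.
  exists u2; split=> //; apply: ex_loopS utn0 _ ex2.
  exact: ex_seq (ex_inc _ _) ex1.
have [s1 [ex1 [b1 q1]]] := exec_clear b s.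
have [|//||s2 [ex2 [t2 [b2 q2]]]] := Hf 0 s1 => //.
  by move=> q qb; apply: q1; lia.
have [||||s3 [ex3 [b3 q3]]] := Hloop y s2; rewrite ?subnn //.
have [|||s4 [ex4 [o4 q4]]] := @exec_copy b o b.+2 s3; try lia.
exists s4; split; first by do ![apply: ex_seq; first by eauto].
split; first by rewrite o4.
by move=> q qb qo; rewrite q4 ?q3 //; lia.
Qed.

Lemma compileP p : compile_correct p.
Proof.
elim/prf_list_ind: p => [||i|f gs|f g|f].
- move=> rs o b s xs y ev rsE ob ors rsb; inversion ev; subst.
  have [s1 [ex1 [o1 q1]]] := exec_clear o s.
  by exists s1; split=> //; split=> // q _; apply: q1.
- move=> rs o b s xs y ev rsE ob ors rsb; inversion ev; subst.
  have [s1 [ex1 [o1 q1]]] := exec_load 0 s ob ors rsb.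
  exists (updV s1 o (s1 o).+1); split; first exact: ex_seq ex1 (ex_inc _ _).
  rewrite updVE eqxx o1 -nth0; split=> // q qb qo.
  by rewrite updVE (negPf qo) q1.
- move=> rs o b s xs y ev rsE ob ors rsb; inversion ev; subst.
  exact: exec_load.
- exact: compile_comp.
- exact: compile_rec.
- exact: compile_mu.
Qed.

(** * Register machines and counter automata *)

Inductive instr : Type :=
| IInc : nat -> nat -> instr
| IJzd : nat -> nat -> nat -> instr
| IHlt : instr.

(* [(z, pc, R)]: program counter [pc] and registers [R]; [z = Some r] is the
   intermediate configuration reached by a successful zero test of [r], in
   which the counter automaton of [r] has popped its bottom marker. *)
Definition config : Type := (option nat * nat * (nat -> nat))%type.

Definition fetch (code : seq instr) (pc : nat) : instr := nth IHlt code pc.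

Definition cstep (code : seq instr) (c : config) : config :=
  let: (z, pc, R) := c in
  if z is Some _ then (None, pc, R) else
  match fetch code pc with
  | IInc r l => (None, l, updV R r (R r).+1)
  | IJzd r l0 l1 =>
      if R r == 0 then (Some r, l0, R) else (None, l1, updV R r (R r).-1)
  | IHlt => c
  end.

Fixpoint csize (c : cmd) : nat :=
  match c with
  | CInc _ | CDec _ => 1
  | CSeq c1 c2 => csize c1 + csize c2
  | CLoop _ c1 => (csize c1).+1
  end.

(** Addresses are absolute: the block is placed at [st] and leaves to [e]. *)
Fixpoint assemble (c : cmd) (st e : nat) : seq instr :=
  match c with
  | CInc r => [:: IInc r e]
  | CDec r => [:: IJzd r e e]
  | CSeq c1 c2 => assemble c1 st (st + csize c1) ++ assemble c2 (st + csize c1) e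
  | CLoop r c1 => IJzd r e st.+1 :: assemble c1 st.+1 st
  end.

Lemma size_assemble c st e : size (assemble c st e) = csize c.
Proof.
by elim: c st e => //= [c1 IH1 c2 IH2|r c IH] st e; rewrite ?size_cat ?IH1 ?IH2 ?IH.
Qed.

Definition reaches (code : seq instr) (c c' : config) : Prop :=
  exists k, iter k (cstep code) c = c'.

Lemma reaches_refl code c : reaches code c c.
Proof. by exists 0. Qed.

Lemma reaches_trans code c1 c2 c3 :
  reaches code c1 c2 -> reaches code c2 c3 -> reaches code c1 c3.
Proof. by move=> [k1 <-] [k2 <-]; exists (k2 + k1); rewrite iterD. Qed.

Lemma reaches_step code c c' : reaches code (cstep code c) c' -> reaches code c c'.
Proof. by apply: reaches_trans; exists 1. Qed.

(** The machine is deterministic: both fixed points equal the iterate after [k1 + k2] steps. *)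
Lemma reaches_halt code c d e : reaches code c d -> reaches code c e ->
  cstep code d = d -> cstep code e = e -> d = e.
Proof.
move=> [k1 <-] [k2 <-] fd fe.
have fix_iter j k : cstep code (iter k (cstep code) c) = iter k (cstep code) c ->
    iter (j + k) (cstep code) c = iter k (cstep code) c.
  by move=> fk; rewrite iterD; elim: j => //= j ->.
by rewrite -(fix_iter k2 _ fd) addnC fix_iter.
Qed.

Definition code_at (code : seq instr) (st : nat) (blk : seq instr) : Prop :=
  forall j, j < size blk -> fetch code (st + j) = nth IHlt blk j.

Lemma code_at_cat code st b1 b2 : code_at code st (b1 ++ b2) ->
  code_at code st b1 /\ code_at code (st + size b1) b2.
Proof.
move=> H; split=> j jb.
  by rewrite H ?size_cat ?ltn_addr // nth_cat jb.
rewrite -addnA H ?size_cat ?ltn_add2l // nth_cat ltnNge leq_addr /=.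
by rewrite addKn.
Qed.

Lemma code_at_cons code st i b : code_at code st (i :: b) ->
  fetch code st = i /\ code_at code st.+1 b.
Proof.
by rewrite -cat1s => /code_at_cat [H1 H2]; split;
  [rewrite -[st]addn0 H1 | rewrite -addn1].
Qed.

Lemma assembleP c s s' : exec c s s' -> forall code st e,
  code_at code st (assemble c st e) -> reaches code (None, st, s) (None, e, s').
Proof.
elim=> {c s s'}.
- move=> r s code st e /code_at_cons [F _]; apply: reaches_step.
  by rewrite /= F; apply: reaches_refl.
- move=> r s r0 code st e /code_at_cons [F _]; apply: reaches_step.
  (* A successful zero test takes two steps, through the intermediate configuration. *)
  by rewrite /= F r0; apply: reaches_step; apply: reaches_refl.
- move=> r s rn0 code st e /code_at_cons [F _]; apply: reaches_step.
  by rewrite /= F ifN; [apply: reaches_refl | apply/eqP].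
- move=> c d s s1 s2 _ IH1 _ IH2 code st e /code_at_cat [].
  rewrite size_assemble => H1 H2.
  exact: reaches_trans (IH1 _ _ _ H1) (IH2 _ _ _ H2).
- move=> r c s r0 code st e /code_at_cons [F _]; apply: reaches_step.
  by rewrite /= F r0; apply: reaches_step; apply: reaches_refl.
- move=> r c s s1 s2 rn0 _ IH1 _ IH2 code st e H.
  have [F H1] := code_at_cons H; apply: reaches_step.
  rewrite /= F ifN; last exact/eqP.
  exact: reaches_trans (IH1 _ _ _ H1) (IH2 _ _ _ H).
Qed.

Definition ireg (i : instr) : seq nat :=
  match i with IInc r _ | IJzd r _ _ => [:: r] | IHlt => [::] end.

Definition itargets (i : instr) : seq nat :=
  match i with IInc _ l => [:: l] | IJzd _ l0 l1 => [:: l0; l1] | IHlt => [::] end.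

Fixpoint cregs (c : cmd) : seq nat :=
  match c with
  | CInc r | CDec r => [:: r]
  | CSeq c1 c2 => cregs c1 ++ cregs c2
  | CLoop r c1 => r :: cregs c1
  end.

Lemma assemble_regs (P : pred nat) c st e :
  all P (cregs c) -> all (fun i => all P (ireg i)) (assemble c st e).
Proof.
elim: c st e => [r|r|c1 IH1 c2 IH2|r c IH] st e /=; rewrite ?andbT //.
  by rewrite !all_cat => /andP[/IH1-> /IH2->].
by move=> /andP[-> /IH->].
Qed.

(* [(tag, i, j)] is a control state of the automaton of counter [i].  Tag 0:
   [j] steps before the [kind] mark, which is thus set exactly at time [i];
   1: loading; 2: end of loading; 3: at program counter [j]; 4, 5: after a
   successful zero test, continuing at [j], where 4 has popped the marker of
   the tested counter. *)
Definition state : Type := (nat * nat * nat)%type.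

Definition a_sync := 0.
Definition a_acc := 1.
Definition a_start := 2.
Definition a_kind := 3.

(** * The pushdown system: one automaton per counter *)

Section Automaton.
Variables (code : seq instr) (n J pacc : nat).

(** Counters that an instruction does not touch move internally to keep the same pace; at a zero
    test of another counter they guess the outcome. *)
Definition ints (s : state) : seq state :=
  let: (tag, i, j) := s in
  match tag with
  | 0 => if j is j'.+1 then [:: (0, i, j')] else [::]
  | 1 => if i == 0 then [::] else [:: (1, i, 0); (2, i, 0)]
  | 2 => if i == 0 then [::] else [:: (3, i, 0)]
  | 3 => match fetch code j with
         | IInc r l => if i == r then [::] else [:: (3, i, l)]
         | IJzd r l0 l1 => if i == r then [::] else [:: (5, i, l0); (3, i, l1)]
         | IHlt => [:: (3, i, j)]
         end
  | 5 => [:: (3, i, j)]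
  | _ => [::]
  end.

(* Stack symbols: [0] is the marker at the bottom, [1] a unit of the counter. *)
Definition calls (s : state) : seq (state * nat) :=
  let: (tag, i, j) := s in
  match tag with
  | 0 => if j is 0 then [:: ((1, i, 0), 0)] else [::]
  | 1 => if i == 0 then [:: ((1, i, 0), 1); ((2, i, 0), 1)] else [::]
  | 2 => if i == 0 then [:: ((3, i, 0), 1)] else [::]
  | 3 => if fetch code j is IInc r l then
           if i == r then [:: ((3, i, l), 1)] else [::]
         else [::]
  | 4 => [:: ((3, i, j), 0)]
  | _ => [::]
  end.

Definition rets (s : state) : seq (nat * state) :=
  let: (tag, i, j) := s in
  if tag is 3 then
    if fetch code j is IJzd r l0 l1 then
      if i == r then [:: (0, (4, i, l0)); (1, (3, i, l1))] else [::]
    else [::]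
  else [::].

(** [a_sync] marks the end of loading and each successful zero test, alike for the tested counter
    (tag 4) and the others (tag 5). *)
Definition label (s : state) : seq nat :=
  let: (tag, i, j) := s in
  match tag with
  | 0 => if j == 0 then [:: a_kind] else [::]
  | 2 => [:: a_sync; a_start]
  | 3 => if j == pacc then [:: a_acc] else [::]
  | 4 | 5 => [:: a_sync]
  | _ => [::]
  end.

Definition states : seq state :=
  [seq (p, j) | p <- [seq (t, i) | t <- iota 0 6, i <- iota 0 n], j <- iota 0 J].

Definition enc (s : state) : nat := pickle s.
Definition dec (x : nat) : state := odflt (0, 0, 0) (unpickle x).

(** Labels are listed by state code; the sum of all codes bounds each of them, so the list is long
    enough. *)
Definition automaton : pds := PDS
  [seq enc (0, i, i) | i <- iota 0 n]
  (flatten [seq [seq (enc s, enc s') | s' <- ints s] | s <- states])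
  (flatten [seq [seq (enc s, enc p.1, p.2) | p <- calls s] | s <- states])
  (flatten [seq [seq (enc s, p.1, enc p.2) | p <- rets s] | s <- states])
  [seq label (dec x) | x <- iota 0 (sumn (map enc states)).+1].

Lemma encK s : dec (enc s) = s.
Proof. by rewrite /dec /enc pickleK. Qed.

(** The steps of [automaton] on decoded states, without the restriction that the source lie in
    [states]. *)
Definition move (s : state) (u : seq nat) (m : mode) (s' : state) (u' : seq nat) :=
  match m with
  | MInt => s' \in ints s /\ u' = u
  | MCall => exists th, (s', th) \in calls s /\ u' = th :: u
  | MRet => exists th u0, u = th :: u0 /\ (th, s') \in rets s /\ u' = u0
  end.

Lemma mem_states t i j : ((t, i, j) \in states) = [&& t < 6, i < n & j < J].
Proof.
rewrite /states; apply/allpairsP/and3P => [[[p j'] [/allpairsP [[t' i'] []]]] |].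
  by rewrite !mem_iota => Ht Hi -> Hj [-> -> ->].
move=> [Ht Hi Hj]; exists ((t, i), j); rewrite mem_iota; split=> //.
by apply/allpairsP; exists (t, i); rewrite !mem_iota.
Qed.

Lemma step_move x u m y u' : pd_step automaton x u m y u' ->
  move (dec x) u m (dec y) u' /\ enc (dec x) = x /\ dec x \in states.
Proof.
case: m => /=.
- move=> [/flatten_mapP [s sS /mapP [s' s'i [-> ->]]] ->].
  by rewrite !encK; do 2!split.
- move=> [th [/flatten_mapP [s sS /mapP [[s' th'] si [-> -> ->]]] ->]].
  by rewrite !encK; split; [exists th' | split].
- move=> [th [u0 [-> [/flatten_mapP [s sS /mapP [[th' s'] si [-> -> ->]]] ->]]]].
  by rewrite !encK; split; [exists th', u0 | split].
Qed.

Lemma move_step s u m s' u' : s \in states -> move s u m s' u' ->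
  pd_step automaton (enc s) u m (enc s') u'.
Proof.
move=> sS; case: m => /=.
- move=> [si ->]; split=> //; apply/flatten_mapP; exists s => //.
  by apply/mapP; exists s'.
- move=> [th [sc ->]]; exists th; split=> //; apply/flatten_mapP; exists s => //.
  by apply/mapP; exists (s', th).
- move=> [th [u0 [-> [sr ->]]]]; exists th, u0; do 2!split=> //.
  by apply/flatten_mapP; exists s => //; apply/mapP; exists (th, s').
Qed.

Lemma leq_sumn x s : x \in s -> x <= sumn s.
Proof.
elim: s => //= y s IHs; rewrite inE => /orP[/eqP->|/IHs]; first exact: leq_addr.
by move=> /leq_trans; apply; apply: leq_addl.
Qed.

Lemma automaton_label s a : s \in states ->
  pd_L 4 automaton (enc s) a = (a \in label s).
Proof.
move=> sS; rewrite /pd_L /pd_lab /automaton (nth_map 0); last first.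
  by rewrite size_iota ltnS leq_sumn // map_f.
rewrite nth_iota; last by rewrite ltnS leq_sumn // map_f.
rewrite add0n encK; case: (boolP (a \in _)); last by rewrite andbF.
case: s {sS} => [[t i] j]; rewrite andbT /label /a_kind /a_sync /a_start /a_acc.
by move: t => [|[|[|[|[|[|t]]]]]] //; try case: eqP => // _;
  rewrite !inE => H; lia.
Qed.

Definition run (st : nat -> state) (stk : nat -> seq nat) (md : nat -> mode) : Prop :=
  forall t, move (st t) (stk t) (md t) (st t.+1) (stk t.+1).

Lemma trace_run tr : pd_trace 4 automaton tr ->
  exists i st stk, i < n /\ st 0 = (0, i, i) /\ stk 0 = [::] /\
    run st stk (tmode tr) /\ forall t a, tlab tr t a = (a \in label (st t)).
Proof.
move=> [st [stk [/mapP [i]]]]; rewrite mem_iota => ilt st0 [stk0 [Hstep Hlab]].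
exists i, (dec \o st), stk; rewrite /= st0 encK; do 3!split=> //.
split=> [t|t a]; first by have [] := step_move (Hstep t).
(* On an infinite path every state is the source of a step, hence lies in [states]. *)
have [_ [stE stS]] := step_move (Hstep t).
by rewrite Hlab /= -automaton_label // stE.
Qed.

Lemma run_trace i st stk md : i < n -> st 0 = (0, i, i) -> stk 0 = [::] ->
  run st stk md -> (forall t, st t \in states) ->
  pd_trace 4 automaton (Trace (fun t a => a \in label (st t)) md).
Proof.
move=> ilt st0 stk0 Hrun stS; exists (enc \o st), stk => /=; split.
  by rewrite st0; apply/mapP; exists i; rewrite ?mem_iota.
split=> //; split=> [t|t a]; first exact: move_step (Hrun t).
by rewrite automaton_label.
Qed.

End Automaton.

(** * Runs forced into step with the machine *)

Section Runs.
Variables (code : seq instr) (n pacc : nat).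

Notation move := (move code).
Notation run := (run code).
Notation label := (label pacc).

(** Tags 3 to 5 are merged, so that the phase never decreases along a run. *)
Definition phase (s : state) : nat := minn 3 s.1.1.

Definition successors (s : state) : seq state :=
  ints code s ++ map fst (calls code s) ++ map snd (rets code s).

Lemma move_successors s u m s' u' : move s u m s' u' -> s' \in successors s.
Proof.
rewrite !mem_cat; case: m => /= [[-> //]|[th [H _]]|[th [u0 [_ [H _]]]]].
  by rewrite (map_f fst H) orbT.
by rewrite (map_f snd H) !orbT.
Qed.

Lemma move_phase s u m s' u' : move s u m s' u' -> phase s <= phase s'.
Proof.
move=> /move_successors; apply/allP: s'; case: s => [[t i] j].
rewrite /successors /=; move: t => [|[|[|[|[|[|t]]]]]] //=; try by case: eqP.
  by case: j.
by case: (fetch code j) => [r l|r l0 l1|] //=; case: eqP.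
Qed.

Lemma run_phase st stk md t d : run st stk md -> phase (st t) <= phase (st (t + d)).
Proof.
move=> Hrun; elim: d => [|d IHd]; first by rewrite addn0.
by apply: leq_trans IHd _; rewrite addnS; apply: move_phase (Hrun _).
Qed.

Section OneRun.
Variables (i : nat) (st : nat -> state) (stk : nat -> seq nat) (md : nat -> mode).
Hypothesis st0 : st 0 = (0, i, i).
Hypothesis stk0 : stk 0 = [::].
Hypothesis Hrun : run st stk md.

Lemma run_pre t : t <= i -> st t = (0, i, i - t) /\ stk t = [::].
Proof.
elim: t => [|t IHt] ti; first by rewrite subn0.
have [stE stkE] := IHt (ltnW ti); have := Hrun t.
have -> : i - t.+1 = (i - t).-1 by lia.
rewrite stE stkE; have : 0 < i - t by lia.
case: (i - t) => //= k _; case: (md t) => /=.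
- by rewrite inE => [[/eqP -> ->]].
- by move=> [th []].
- by move=> [th [u0 []]].
Qed.

Lemma run_load_entry : st i.+1 = (1, i, 0) /\ stk i.+1 = [:: 0].
Proof.
have [stE stkE] := run_pre (leqnn i); have := Hrun i.
rewrite stE stkE subnn; case: (md i) => /=.
- by case.
- by move=> [th []]; rewrite inE => /eqP [-> ->] ->.
- by move=> [th [u0 []]].
Qed.

(** The time of the mark reveals the counter, so a formula can tie each trace variable to its
    counter. *)
Lemma run_kind t : a_kind \in label (st t) -> t = i.
Proof.
have [ti|it] := leqP t i.
  have [-> _] := run_pre ti => /=; case: eqP => //; lia.
have := run_phase i.+1 (t - i.+1) Hrun; rewrite subnKC //.
rewrite (proj1 run_load_entry); case: (st t) => [[tg i'] j].
move: tg => [|[|[|[|[|[|tg]]]]]] //= _; by case: eqP.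
Qed.

(** Counter 0 holds only the marker at time 1 and gains a unit per step; the step leaving tag 2 at
    time [x] brings it to [x] units. *)
Definition lstack (t : nat) : seq nat :=
  (if i == 0 then nseq t.-1 1 else [::]) ++ [:: 0].

Lemma move_load u m s' u' : move (1, i, 0) u m s' u' ->
  (s' = (1, i, 0) \/ s' = (2, i, 0)) /\ u' = if i == 0 then 1 :: u else u.
Proof.
case: m => /=; case: (i =P 0) => [->|_] /=.
- by case.
- by move=> [H ->]; split=> //; move: H; rewrite !inE => /orP[/eqP|/eqP]; auto.
- move=> [th []]; rewrite !inE => /orP[|] /eqP [-> ->] ->; auto.
- by move=> [th []].
- by move=> [th [u0 [_ []]]].
- by move=> [th [u0 [_ []]]].
Qed.

Lemma run_load t : i < t ->
  (forall t', t' <= t -> a_sync \notin label (st t')) ->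
  st t = (1, i, 0) /\ stk t = lstack t.
Proof.
move=> /subnKC <-; elim: (t - i.+1) => [|d IHd] H.
  rewrite addn0; have [-> ->] := run_load_entry.
  by rewrite /lstack; case: eqP => [->|].
have [stE stkE] : st (i.+1 + d) = (1, i, 0) /\ stk (i.+1 + d) = lstack (i.+1 + d).
  by apply: IHd => t' t'd; apply: H; lia.
have := Hrun (i.+1 + d); rewrite stE stkE -addnS => /move_load [sE ->].
have := H _ (leqnn _); case: sE => -> // _; split=> //.
by rewrite /lstack; case: eqP => // ->; rewrite !addSn !add0n.
Qed.

Definition input_regs (x : nat) : nat -> nat := fun r => if r == 0 then x else 0.

Definition cstate (c : config) (k : nat) : state :=
  let: (z, pc, _) := c in
  if z is Some r then (if k == r then 4 else 5, k, pc) else (3, k, pc).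

Definition cstack (c : config) (k : nat) : seq nat :=
  let: (z, _, R) := c in
  if z == Some k then [::] else nseq (R k) 1 ++ [:: 0].

Lemma run_enter x : i.+1 < x ->
  (forall t, t < x -> a_sync \notin label (st t)) -> a_sync \in label (st x) ->
  st x.+1 = cstate (None, 0, input_regs x) i /\
  stk x.+1 = cstack (None, 0, input_regs x) i.
Proof.
case: x => // x; rewrite ltnS => ix Hlt Hx.
have [stE stkE] := run_load ix Hlt.
have := Hrun x; rewrite stE stkE => /move_load [sE stkE'].
case: sE => stE'; first by move: Hx; rewrite stE'.
have x_gt0 : 0 < x by apply: leq_ltn_trans ix.
have := Hrun x.+1; rewrite stE' stkE' /cstate /cstack /input_regs /lstack /=.
case: (md x.+1) => /=; case: (i =P 0) => [i0|_] /=.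
- by case.
- by rewrite inE => [[/eqP -> ->]].
- move=> [th []]; rewrite inE => /eqP [-> ->] ->; rewrite i0.
  by case: (x) x_gt0.
- by move=> [th []].
- by move=> [th [u0 [_ []]]].
- by move=> [th [u0 [_ []]]].
Qed.

(** [a_start] marks only tag 2, which lasts one step and is not entered again, so counter 0 is still
    loading at all times from 1 to before [x]. *)
Lemma run_start x : i = 0 -> a_start \in label (st x) ->
  (forall t, t < x -> a_sync \notin label (st t)) /\ a_sync \in label (st x).
Proof.
move=> i0 Hx; have stx : (st x).1.1 = 2.
  case: (st x) Hx => [[tg k] j].
  by move: tg => [|[|[|[|[|[|tg]]]]]] //=; case: eqP.
split; last by case: (st x) stx => [[tg k] j] /= ->.
have x_gt0 : 0 < x.
  by case: x stx {Hx} => //; rewrite st0.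
suff H t : 0 < t < x -> st t = (1, 0, 0).
  case=> [_|t tx]; first by rewrite st0 i0.
  by rewrite H.
elim: t => // t IHt /andP[_ tx].
have [t0|t_gt0] := posnP t; first by have [] := run_load_entry; rewrite t0 i0.
have := Hrun t; rewrite IHt ?t_gt0 1?ltnW // => Hm.
have : st t.+1 \in successors (1, 0, 0) := move_successors Hm.
rewrite /successors /= !inE => /orP[/eqP-> //|/eqP E].
(* Had loading ended at [t.+1 < x], the run would be in phase 3 at [t.+2], yet it is in phase 2 at
   [x]. *)
have := move_phase (Hrun t.+1); rewrite E.
have := run_phase t.+2 (x - t.+2) Hrun; rewrite subnKC // /phase stx.
have := move_successors (Hrun t.+1); rewrite E /successors /= inE => /eqP ->.
by [].
Qed.

End OneRun.

(** The tested counter has an empty stack in the intermediate configuration; since its register is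
    0, pushing the marker back restores the right stack. *)
Definition zero_tested (c : config) : Prop :=
  if c.1.1 is Some r then c.2 r = 0 else True.

Lemma cstep_zero_tested c : zero_tested c -> zero_tested (cstep code c).
Proof.
case: c => [[[z|] pc] R] //= _; case: (fetch code pc) => //= r l0 l1.
by rewrite /zero_tested; case: eqP.
Qed.

(* All automata are in step with [c]; since the automaton of the tested counter
   cannot guess the outcome of the test wrongly, agreement on the [sync] mark
   forces the right guess on all others. *)
Lemma lockstep c (st st' : nat -> state) (stk stk' : nat -> seq nat) (md : nat -> mode) :
  zero_tested c -> 0 < n ->
  all (fun i => all (fun r => r < n) (ireg i)) code ->
  (forall k, k < n -> st k = cstate c k /\ stk k = cstack c k) ->
  (forall k, k < n -> move (st k) (stk k) (md k) (st' k) (stk' k)) ->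
  (forall k, k < n ->
     (a_sync \in label (st' k)) = (a_sync \in label (st' 0))) ->
  forall k, k < n -> st' k = cstate (cstep code c) k /\
                     stk' k = cstack (cstep code c) k.
Proof.
case: c => [[z pc] R] zt n_gt0 Hreg Hst Hmv Hsync k kn.
have {}Hmv q : q < n -> move (cstate (z, pc, R) q) (cstack (z, pc, R) q) (md q)
    (st' q) (stk' q).
  by move=> qn; have := Hmv q qn; have [-> ->] := Hst q qn.
case: z zt {Hst} Hmv => [r|]; rewrite /zero_tested /= => zt Hmv.
  have := Hmv k kn; case: (md k); rewrite (inj_eq Some_inj) eq_sym;
    case: eqP => [<-|kr] /=.
  - by case.
  - by rewrite inE => [[/eqP -> ->]].
  - by move=> [th []]; rewrite inE => /eqP[-> ->] ->; rewrite zt.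
  - by move=> [th []].
  - by move=> [th [u0 []]].
  - by move=> [th [u0 [_ []]]].
(* Past the end of the code [fetch] returns [IHlt], which mentions no register. *)
have Hr : all (fun r => r < n) (ireg (fetch code pc)).
  have [pcs|pcs] := ltnP pc (size code); last by rewrite /fetch nth_default.
  exact: (all_nthP IHlt Hreg).
case Hf: (fetch code pc) Hr => [r l|r l0 l1|] /=.
- rewrite andbT => rn; have := Hmv k kn; rewrite /updV.
  case: (md k) => /=; rewrite Hf; case: (k =P r) => [->|kr] /=.
  + by case.
  + by rewrite inE => [[/eqP -> ->]].
  + by move=> [th []]; rewrite inE => /eqP[-> ->] ->.
  + by move=> [th []].
  + by move=> [th [u0 [_ []]]].
  + by move=> [th [u0 [_ []]]].
- rewrite andbT => rn.
  have {Hsync} Hsync q : q < n ->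
      (a_sync \in label (st' q)) = (a_sync \in label (st' r)).
    by move=> qn; rewrite (Hsync q) // (Hsync r).
  (* The top of its stack decides for the tested counter: the marker allows only the jump to [l0], a
     unit only the one to [l1]. *)
  have [srE skE] : st' r = (if R r == 0 then (4, r, l0) else (3, r, l1)) /\
      stk' r = if R r == 0 then [::] else nseq (R r).-1 1 ++ [:: 0].
    have := Hmv r rn; case: (md r) => /=; rewrite Hf ?eqxx /=.
    + by case.
    + by move=> [th []].
    + move=> [th [u0 []]]; case: (R r) => [|m] /= [<- <-] [];
        by rewrite !inE => /orP[|] /eqP[] // -> ->.
  have := Hsync k kn; rewrite srE; have := Hmv k kn.
  have [->|kr] := eqVneq k r => [_ _|].
    by rewrite srE skE /updV; case: (R r == 0) => /=; rewrite !eqxx.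
  case: (md k) => /=; rewrite Hf ?(negPf kr) /=.
  (* Of the two guesses only tag 5 carries [a_sync], so agreement with counter [r] excludes the
     wrong one. *)
  + rewrite !inE => [[/orP[/eqP->|/eqP->] ->]] /=; case: (R r == 0) => //=;
      rewrite /updV ?(inj_eq Some_inj) ?(eq_sym r) (negPf kr) //;
      by case: (l1 == pacc).
  + by move=> [th []].
  + by move=> [th [u0 [_ []]]].
- have := Hmv k kn; case: (md k) => /=; rewrite Hf.
  + by rewrite inE => [[/eqP -> ->]].
  + by move=> [th []].
  + by move=> [th [u0 [_ []]]].
Qed.

End Runs.

(** * Agreeing runs correspond to accepting computations *)

Section Paths.
Variables (code : seq instr) (n J pacc x : nat).

Definition conf (m : nat) : config :=
  iter m (cstep code) (None, 0, input_regs x).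

Lemma conf_zero_tested m : zero_tested (conf m).
Proof. by elim: m => //= m; apply: cstep_zero_tested. Qed.

Lemma label_acc s : a_acc \in label pacc s -> s.1.1 = 3 /\ s.2 = pacc.
Proof.
case: s => [[t i] j]; move: t => [|[|[|[|[|[|t]]]]]] //=; first by case: eqP.
by case: (j =P pacc).
Qed.

Lemma cstate_acc c i : a_acc \in label pacc (cstate c i) ->
  c.1 = (None, pacc).
Proof.
move/label_acc; case: c => [[[r|] pc] R] /= []; first by case: eqP.
by move=> _ ->.
Qed.

(** The start mark makes [x] the loaded value, and agreement on [a_sync] up to [T] keeps all runs on
    [conf], so the acceptance mark at [T] is the machine's own. *)
Lemma runs_accept T (st : nat -> nat -> state) (stk : nat -> nat -> seq nat)
    (md : nat -> nat -> mode) :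
  0 < n -> n < x -> all (fun i => all (fun r => r < n) (ireg i)) code ->
  (forall k, k < n -> [/\ st k 0 = (0, k, k), stk k 0 = [::] &
                         run code (st k) (stk k) (md k)]) ->
  a_start \in label pacc (st 0 x) ->
  (forall k t, k < n -> t <= T ->
     (a_sync \in label pacc (st k t)) = (a_sync \in label pacc (st 0 t))) ->
  a_acc \in label pacc (st 0 T) ->
  exists m, (conf m).1 = (None, pacc).
Proof.
move=> n_gt0 n_lt_x code_regs Hst Hstart Hsync Hacc; have [st0 stk0 run0] := Hst 0 n_gt0.
have [Hlt Hx] := run_start st0 stk0 run0 erefl Hstart.
(* The acceptance mark belongs to phase 3, the start mark to phase 2, and phases never decrease. *)
have xT : x < T.
  rewrite ltnNge; apply/negP => /subnKC Tx.
  have := run_phase T (x - T) run0; rewrite Tx /phase (proj1 (label_acc Hacc)).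
  case: (st 0 x) Hx Hstart => [[t i] j].
  by move: t => [|[|[|[|[|[|t]]]]]] //=; case: eqP.
have H m : x.+1 + m <= T -> forall k, k < n ->
    st k (x.+1 + m) = cstate (conf m) k /\ stk k (x.+1 + m) = cstack (conf m) k.
  elim: m => [|m IHm] mT k kn.
    have [stk0' stkk0 runk] := Hst k kn; rewrite addn0.
    apply: (run_enter (pacc := pacc) stk0' stkk0 runk); first by lia.
      by move=> t tx; rewrite Hsync //; [apply: Hlt | lia].
    by rewrite Hsync //; lia.
  rewrite addnS in mT *; rewrite /conf iterS -/(conf m).
  apply: (@lockstep code n pacc (conf m) (st^~ (x.+1 + m)) (st^~ (x.+1 + m).+1)
    (stk^~ (x.+1 + m)) (stk^~ (x.+1 + m).+1) (md^~ (x.+1 + m))) => //.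
  - exact: conf_zero_tested.
  - by apply: IHm; apply: ltnW.
  - by move=> q qn; have [_ _] := Hst q qn; apply.
  - by move=> q qn; apply: Hsync.
exists (T - x.+1); have [] := H (T - x.+1) _ 0 n_gt0; rewrite subnKC //.
by move=> stE _; apply: (@cstate_acc _ 0); rewrite -stE.
Qed.

(** The run of counter [i] that guesses everything correctly; machine step [m] happens at time
    [x.+1 + m]. *)
Definition path (i t : nat) : state :=
  if t <= i then (0, i, i - t) else
  if t < x then (1, i, 0) else
  if t == x then (2, i, 0) else cstate (conf (t - x.+1)) i.

Definition pstack (i t : nat) : seq nat :=
  if t <= i then [::] else
  if t <= x then lstack i t else cstack (conf (t - x.+1)) i.

(** Each step changes the stack height by at most one, so the heights determine the mode. *)
Definition mode_of (u u' : seq nat) : mode :=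
  if size u < size u' then MCall else if size u' < size u then MRet else MInt.

Definition pmode (i t : nat) : mode := mode_of (pstack i t) (pstack i t.+1).

Lemma mode_of_int u : mode_of u u = MInt.
Proof. by rewrite /mode_of ltnn. Qed.

Lemma mode_of_call th u : mode_of u (th :: u) = MCall.
Proof. by rewrite /mode_of leqnn. Qed.

Lemma mode_of_ret th u : mode_of (th :: u) u = MRet.
Proof. by rewrite /mode_of ltnNge leqnSn leqnn. Qed.

Lemma cstep_move c i : zero_tested c ->
  move code (cstate c i) (cstack c i) (mode_of (cstack c i) (cstack (cstep code c) i))
    (cstate (cstep code c) i) (cstack (cstep code c) i).
Proof.
case: c => [[[r|] pc] R]; rewrite /zero_tested /=.
  rewrite (inj_eq Some_inj) eq_sym; case: eqP => [->|_] R0 /=.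
    by rewrite R0 mode_of_call; exists 0; rewrite inE.
  by rewrite mode_of_int /= inE.
move=> _; case Hf: (fetch code pc) => [r l|r l0 l1|] /=.
- rewrite /updV; case: (i =P r) => [->|/eqP ir] /=.
    by rewrite mode_of_call /= Hf eqxx; exists 1; rewrite inE.
  by rewrite mode_of_int /= Hf (negPf ir) inE.
- case: (i =P r) => [->|/eqP ir].
    case E: (R r) => [|m] /=.
      rewrite !eqxx mode_of_ret /= Hf eqxx.
      by exists 0, [::]; rewrite !inE eqxx.
    rewrite /updV !eqxx mode_of_ret /= Hf eqxx.
    by exists 1, (nseq m 1 ++ [:: 0]); rewrite !inE eqxx orbT.
  case: (R r == 0) => /=; rewrite ?(inj_eq Some_inj) /updV ?(eq_sym r) (negPf ir);
    by rewrite mode_of_int /= Hf (negPf ir) !inE eqxx ?orbT.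
- by rewrite mode_of_int /= Hf inE.
Qed.

Lemma path_run i : n < x -> i < n -> run code (path i) (pstack i) (pmode i).
Proof.
move=> n_lt_x i_lt t; rewrite /pmode /path /pstack.
have [ti|it] := leqP t.+1 i.
  rewrite ltnW // mode_of_int /= subnS; have : 0 < i - t by lia.
  by case: (i - t) => //= k _; rewrite inE.
have [ti|it'] := leqP t i.
  have -> : t = i by lia.
  have -> : i.+1 < x by lia.
  rewrite ltnW ?subnn; last by lia.
  have -> : lstack i i.+1 = [:: 0] by rewrite /lstack; case: eqP => [->|].
  by rewrite (mode_of_call 0 [::]); exists 0; rewrite inE.
have [tx|xt] := ltnP t x.
  rewrite (ltnW tx); have -> : lstack i t.+1 = if i == 0 then 1 :: lstack i t else lstack i t.
    rewrite /lstack; case: eqP => // i0 /=.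
    by rewrite -[in LHS](@prednK t) //; lia.
  have -> : (if t.+1 < x then (1, i, 0) else if t.+1 == x then (2, i, 0) else
      cstate (conf (t.+1 - x.+1)) i) = if t.+1 < x then (1, i, 0) else (2, i, 0).
    by case: ltnP => // ?; rewrite ifT //; lia.
  have [i0|i0] := eqVneq i 0; [rewrite mode_of_call | rewrite mode_of_int] => /=.
    by exists 1; rewrite i0 /=; case: ifP; rewrite !inE eqxx ?orbT.
  by rewrite (negPf i0) /=; case: ifP; rewrite !inE eqxx ?orbT.
have -> : (t.+1 < x) = false by lia.
have -> : (t.+1 == x) = false by lia.
rewrite subSS; have [->|tx] := eqVneq t x.
  rewrite leqnn subnn /= /lstack /input_regs; case: (i =P 0) => [->|/eqP i0] /=.
    have -> : nseq x 1 = 1 :: nseq x.-1 1 by case: (x) n_lt_x.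
    by rewrite mode_of_call; exists 1; rewrite inE.
  by rewrite ?mode_of_int /= (negPf i0) inE.
have -> : (t <= x) = false by lia.
have -> : t - x = (t - x.+1).+1 by lia.
by apply: cstep_move; apply: conf_zero_tested.
Qed.

Lemma conf_pc m : 0 < J ->
  all (fun i => all (fun l => l < J) (itargets i)) code -> (conf m).1.2 < J.
Proof.
move=> J_gt0 code_targets.
elim: m => [|m] //=.
case: (conf m) => [[[r|] pc] R] //=.
have [pcs|pcs] := ltnP pc (size code); last by rewrite /fetch nth_default.
have := all_nthP IHlt code_targets _ pcs; rewrite -/(fetch code pc).
case: (fetch code pc) => [r l|r l0 l1|] //=; first by rewrite andbT.
by case: (R r == 0) => /andP[? /andP[]].
Qed.

Lemma path_states i t : n <= J ->
  all (fun i => all (fun l => l < J) (itargets i)) code ->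
  i < n -> path i t \in states n J.
Proof.
move=> n_le_J code_targets i_lt; rewrite /path.
have [ti|it] := leqP t i; first by rewrite mem_states i_lt /=; lia.
have J_gt0 : 0 < J by lia.
case: ltnP => _; first by rewrite mem_states i_lt.
case: eqP => _; first by rewrite mem_states i_lt.
have := conf_pc (t - x.+1) J_gt0 code_targets; case: (conf _) => [[[r|] pc] R] /= pcJ.
  by case: ifP => _; rewrite mem_states i_lt.
by rewrite mem_states i_lt.
Qed.

Definition ptrace (i : nat) : trace :=
  Trace (fun t a => a \in label pacc (path i t)) (pmode i).

Lemma ptrace_in i : n < x -> n <= J ->
  all (fun i => all (fun l => l < J) (itargets i)) code -> i < n ->
  pd_trace 4 (automaton code n J pacc) (ptrace i).
Proof.
move=> n_lt_x n_le_J code_targets i_lt.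
apply: (@run_trace code n J pacc i (path i) (pstack i) (pmode i)) => //.
- by rewrite /path leq0n subn0.
- exact: path_run.
- by move=> t; apply: path_states.
Qed.

Lemma ptrace_kind i : tlab (ptrace i) i a_kind.
Proof. by rewrite /= /path leqnn subnn. Qed.

Lemma ptrace_start : 0 < x -> tlab (ptrace 0) x a_start.
Proof. by move=> x_gt0; rewrite /= /path leqNgt x_gt0 ltnn eqxx. Qed.

Lemma ptrace_sync i t : 0 < n -> n < x -> i < n ->
  tlab (ptrace i) t a_sync = tlab (ptrace 0) t a_sync.
Proof.
move=> n_gt0 n_lt_x i_lt.
(* The mark depends on the time and the machine only: it is set at [x] and at intermediate
   configurations. *)
have H k : k < n -> tlab (ptrace k) t a_sync =
    (t == x) || (x < t) && (conf (t - x.+1)).1.1.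
  move=> kn; rewrite /= /path.
  have [tk|kt] := leqP t k.
    have -> : (t == x) = false by lia.
    have -> : (x < t) = false by lia.
    by rewrite /label; case: (k - t == 0).
  case: (ltngtP t x) => //=.
  move=> _; case: (conf _) => [[[r|] pc] R] /=; first by case: ifP.
  by case: (pc == pacc).
by rewrite !H.
Qed.

Lemma ptrace_acc m : (conf m).1 = (None, pacc) ->
  tlab (ptrace 0) (x.+1 + m) a_acc.
Proof.
move=> cE; rewrite /= /path.
have -> : (x.+1 + m <= 0) = false by lia.
have -> : (x.+1 + m < x) = false by lia.
have -> : (x.+1 + m == x) = false by lia.
by rewrite addKn; case: (conf m) cE => [_ R] /= ->; rewrite /= eqxx.
Qed.

End Paths.

(** * The formula *)

(** Mumbling with a valid formula turns the mumbling successor into the ordinary one. *)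
Definition ttrue : tform := TOr (TAp 0) (TNeg (TAp 0)).

Lemma tsem_true tr V i : tsem tr V ttrue i.
Proof. by rewrite /=; case: (tlab tr i 0); [left | right]. Qed.

Lemma succ_delta_true tr i j : succ_delta tr ttrue i j <-> j = i.+1.
Proof.
split=> [|->]; last first.
  by left; split; [apply: tsem_true | split=> // j'; lia].
case=> [[_ [ij H]] | [_ //]]; apply/eqP; apply: contraT => ne.
by case: (H i.+1); [lia | apply: tsem_true].
Qed.

Lemma tsem_nexts tr V d x i : tsem tr V (iter x (TNext Sg) d) i <-> tsem tr V d (i + x).
Proof.
elim: x i => [|x IHx] i; first by rewrite addn0.
rewrite addnS -addSn -IHx /=; split=> [[j [-> //]]|H].
by exists i.+1.
Qed.

Definition MAnd (p q : mform) : mform := MNeg (MOr (MNeg p) (MNeg q)).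

Lemma msem_and Pi W p q v : msem Pi W (MAnd p q) v <-> msem Pi W p v /\ msem Pi W q v.
Proof.
split=> /= [H|[Hp Hq] []] //.
by split; apply: NNPP => ?; apply: H; [left | right].
Qed.

Definition MAll (s : seq nat) (F : nat -> mform) : mform :=
  foldr MAnd (MAt ttrue 0) (map F s).

Lemma msem_all Pi W s F v :
  msem Pi W (MAll s F) v <-> (forall i, i \in s -> msem Pi W (F i) v).
Proof.
rewrite /MAll; elim: s => [|i s IHs]; first by split=> // _; apply: tsem_true.
rewrite msem_and IHs; split=> [[Hi Hs] j|H].
  by rewrite inE => /orP[/eqP->|/Hs].
by split=> [|j js]; apply: H; rewrite inE ?eqxx // js orbT.
Qed.

Definition step_all (n : nat) : mumbling := [seq (i, ttrue) | i <- iota 0 n].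

Lemma lookup_step_all n pi :
  lookupD (step_all n) pi = if pi < n then Some ttrue else None.
Proof.
rewrite -[pi < n]/((0 <= pi) && (pi < 0 + n)) -mem_iota /step_all.
by elim: (iota 0 n) => //= i s IHs; rewrite inE eq_sym; case: eqP.
Qed.

Definition advance (n : nat) (v : vec) : vec := fun pi => if pi < n then (v pi).+1 else v pi.

Lemma succ_step_all Pi n v w :
  succ_Delta Pi (step_all n) v w <-> w =1 advance n v.
Proof.
split=> H pi; have := H pi; rewrite lookup_step_all /advance.
  by case: (pi < n) => // /succ_delta_true.
by case: (pi < n) => // ->; apply/succ_delta_true.
Qed.

Definition sync_iff (i : nat) : mform :=
  let B k := MAt (TAp a_sync) k in
  MOr (MAnd (B i) (B 0)) (MNeg (MOr (B i) (B 0))).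

(** An until as a least fixpoint: agreement is demanded up to and including some time at which trace
    0 carries [a_acc]. *)
Definition sync_until_acc (n : nat) : mform :=
  MMu 0 (MAnd (MAll (iota 0 n) sync_iff)
              (MOr (MAt (TAp a_acc) 0) (MNext (step_all n) (MVar 0)))).

Lemma msem_sync_iff Pi W i v : msem Pi W (sync_iff i) v <->
  tlab (Pi i) (v i) a_sync = tlab (Pi 0) (v 0) a_sync.
Proof.
rewrite /sync_iff; set p := MAnd _ _; rewrite -[msem _ _ (MOr p _) v]/(msem Pi W p v \/ _).
have T : is_true true by []; have F : ~ is_true false by [].
by rewrite msem_and /=; case: (tlab _ _ _); case: (tlab _ _ _); intuition.
Qed.

Lemma msem_mu Pi W y p v : msem Pi W (MMu y p) v <->
  forall I, (forall w, msem Pi (updV W y I) p w -> I w) -> I v.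
Proof. by []. Qed.

Lemma msem_sync_until_acc Pi W n v : 0 < n ->
  msem Pi W (sync_until_acc n) v <->
  exists T, tlab (Pi 0) (v 0 + T) a_acc /\
    forall i t, i < n -> t <= T ->
      tlab (Pi i) (v i + t) a_sync = tlab (Pi 0) (v 0 + t) a_sync.
Proof.
move=> n_gt0; rewrite msem_mu; split.
  (* The right-hand side, as a set of vectors, is closed under the fixpoint body, so it contains the
     least fixpoint. *)
  move=> H; pattern v; apply: H => {}v /msem_and [/msem_all Hs Hacc].
  have {}Hs i : i < n -> tlab (Pi i) (v i) a_sync = tlab (Pi 0) (v 0) a_sync.
    by move=> ilt; apply/(msem_sync_iff Pi W); apply: Hs; rewrite mem_iota.
  case: Hacc => [/= Hacc|[w [/succ_step_all wE]]].
    exists 0; rewrite addn0; split=> // i t ilt; rewrite leqn0 => /eqP->.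
    by rewrite !addn0; apply: Hs.
  rewrite /= /updV eqxx => -[T [HT Hsync]]; exists T.+1.
  have wE' i : i < n -> w i = (v i).+1 by move=> ilt; rewrite wE /advance ilt.
  rewrite -addSnnS -wE' //; split=> // i [|t] ilt tT.
    by rewrite !addn0; apply: Hs.
  by rewrite -!addSnnS -!wE' //; apply: Hsync.
(* Conversely, induction on [T] puts every such vector into each closed set [I]. *)
case=> T [HT Hsync] I HI; elim: T v HT Hsync => [|T IHT] v HT Hsync;
    apply: HI; rewrite msem_and; split.
- apply/msem_all => i; rewrite mem_iota => /= ilt; apply/(msem_sync_iff Pi W).
  by have := Hsync i 0 ilt (leqnn _); rewrite !addn0.
- by left; rewrite /= -[v 0]addn0.
- apply/msem_all => i; rewrite mem_iota => /= ilt; apply/(msem_sync_iff Pi W).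
  by have := Hsync i 0 ilt (leq0n _); rewrite !addn0.
right; exists (advance n v); split; first exact/succ_step_all.
rewrite /= /updV eqxx; apply: IHT; first by rewrite /advance n_gt0 addSnnS.
by move=> i t ilt tT; rewrite /advance ilt n_gt0 !addSnnS; apply: Hsync.
Qed.

Definition kinds (n : nat) : mform :=
  MAll (iota 0 n) (fun i => MAt (iter i (TNext Sg) (TAp a_kind)) i).

Definition start_at (x : nat) : mform := MAt (iter x (TNext Sg) (TAp a_start)) 0.

Definition Exs (s : seq nat) (p : mform) : hform := foldr HEx (HM p) s.

Definition formula (n x : nat) : hform :=
  Exs (iota 0 n) (MAnd (MAnd (kinds n) (sync_until_acc n)) (start_at x)).

Lemma hsat_Exs T Pi s p : hsat T Pi (Exs s p) <->
  exists Pi', (forall i, if i \in s then T (Pi' i) else Pi' i = Pi i) /\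
              msem Pi' W0 p (fun _ => 0).
Proof.
elim: s Pi => [|a s IHs] Pi /=.
  split=> [H|[Pi' [E H]]]; first by exists Pi.
  by rewrite -(functional_extensionality _ _ E).
split=> [[tr [Ttr /IHs [Pi' [HPi' Hp]]]]|[Pi' [HPi' Hp]]].
  exists Pi'; split=> // i; have := HPi' i; rewrite inE /updV orbC.
  by case: (i \in s) => //=; case: eqP => // _ ->.
exists (Pi' a); split; first by have := HPi' a; rewrite inE eqxx.
apply/IHs; exists Pi'; split=> // i; have := HPi' i; rewrite inE /updV orbC.
by case: (i \in s) => //=; case: eqP => // ->.
Qed.

Lemma t_ok_nexts k B x d : t_ok k B (iter x (TNext Sg) d) = t_ok k B d.
Proof. by elim: x. Qed.

Lemma m_ok_all k TV B s F : 0 < k -> 0 \in TV ->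
  m_ok k TV B (MAll s F) = all (fun i => m_ok k TV B (F i)) s.
Proof.
move=> k0 TV0; rewrite /MAll; elim: s => [|i s IHs] /=; first by rewrite k0 TV0.
by rewrite IHs.
Qed.

Lemma mpos_all x b s F : mpos x b (MAll s F) = all (fun i => mpos x b (F i)) s.
Proof. by rewrite /MAll; elim: s => //= i s IHs; rewrite !negbK IHs. Qed.

Lemma m_Deltas_all s F : (forall i, m_Deltas (F i) = [::]) -> m_Deltas (MAll s F) = [::].
Proof. by move=> H; rewrite /MAll; elim: s => //= i s ->; rewrite H. Qed.

Lemma h_ok_Exs k TV s p : h_ok k TV (Exs s p) = m_ok k (rev s ++ TV) [::] p.
Proof.
elim: s TV => //= a s IHs TV; rewrite IHs rev_cons -cats1 -catA //.
Qed.

Lemma formula_wf n x : 0 < n -> wf_input 4 (formula n x).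
Proof.
move=> n_gt0; split.
  rewrite /formula h_ok_Exs cats0; set TV := rev _.
  have TVE i : (i \in TV) = (i < n) by rewrite mem_rev mem_iota.
  rewrite /= t_ok_nexts !m_ok_all ?TVE // mpos_all /= n_gt0 !andbT.
  apply/and3P; split; [|apply/and4P; split=> //|].
  - by apply/allP => i; rewrite mem_iota t_ok_nexts TVE.
  - by apply/allP => i; rewrite mem_iota /= !TVE n_gt0 => ->.
  - by apply/allP => i; rewrite TVE lookup_step_all => ->.
  - by rewrite /step_all all_map; apply/allP.
  - by apply/allP.
have DE : h_Deltas (formula n x) = [:: step_all n].
  rewrite /formula /Exs; elim: {1}(iota 0 n) => //=.
  by rewrite !m_Deltas_all.
by move=> D1 D2; rewrite DE => -[<-|[]] [<-|[]].
Qed.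

Lemma formula_models code n J pacc x : 0 < n -> n < x -> n <= J ->
  all (fun i => all (fun r => r < n) (ireg i)) code ->
  all (fun i => all (fun l => l < J) (itargets i)) code ->
  hmodels (pd_trace 4 (automaton code n J pacc)) (formula n x) <->
  exists m, (conf code x m).1 = (None, pacc).
Proof.
move=> n_gt0 n_lt_x n_le_J Hregs Htargets; rewrite /hmodels hsat_Exs; split.
  case=> Pi [HPi /msem_and [/msem_and [/msem_all Hk Hs] Hx]].
  have {}HPi i : i < n -> exists p : (nat -> state) * (nat -> seq nat),
      [/\ p.1 0 = (0, i, i), p.2 0 = [::], run code p.1 p.2 (tmode (Pi i)) &
      forall t a, tlab (Pi i) t a = (a \in label pacc (p.1 t))].
    move=> ilt; have := HPi i; rewrite mem_iota ilt => /trace_run.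
    move=> [k [st [stk [kn [st0 [stk0 [Hrun Hlab]]]]]]].
    have : msem Pi W0 (MAt (iter i (TNext Sg) (TAp a_kind)) i) (fun _ => 0).
      by apply: Hk; rewrite mem_iota.
    move/tsem_nexts => /=; rewrite add0n Hlab => Hki.
    by exists (st, stk); have ik := run_kind st0 stk0 Hrun Hki; split=> //=; rewrite st0 -ik.
  have [p Hp] : exists p : nat -> (nat -> state) * (nat -> seq nat), forall i, i < n ->
      [/\ (p i).1 0 = (0, i, i), (p i).2 0 = [::], run code (p i).1 (p i).2 (tmode (Pi i)) &
      forall t a, tlab (Pi i) t a = (a \in label pacc ((p i).1 t))].
    (* The bound moves under the existential, with a dummy pair out of range, so that choice applies
       to all [i]. *)
    have H i : exists p : (nat -> state) * (nat -> seq nat), i < n ->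
      [/\ p.1 0 = (0, i, i), p.2 0 = [::], run code p.1 p.2 (tmode (Pi i)) &
      forall t a, tlab (Pi i) t a = (a \in label pacc (p.1 t))].
      have [/HPi [p Hp]|_] := boolP (i < n); first by exists p.
      by exists (fun _ => (0, 0, 0), fun _ => [::]).
    by exists (fun i => proj1_sig (constructive_indefinite_description _ (H i)));
       move=> i; apply: proj2_sig (constructive_indefinite_description _ (H i)).
  have [T [HT Hsync]] : exists T, tlab (Pi 0) T a_acc /\ forall i t, i < n -> t <= T ->
      tlab (Pi i) t a_sync = tlab (Pi 0) t a_sync.
    by have /msem_sync_until_acc := Hs; apply.
  have [_ _ _ lab0] := Hp 0 n_gt0.
  apply: (@runs_accept code n pacc x T (fun i => (p i).1)
    (fun i => (p i).2) (fun i => tmode (Pi i))) => //.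
  - by move=> k /Hp [].
  - by move/tsem_nexts: Hx => /=; rewrite lab0.
  - by move=> k t kn tT; have [_ _ _ labk] := Hp k kn; rewrite -labk -lab0 Hsync.
  - by rewrite -lab0.
case=> m Hm.
exists (fun i => if i < n then ptrace code pacc x i else default_trace); split.
  move=> i; rewrite mem_iota /= add0n; case: (boolP (i < n)) => // ilt.
  exact: ptrace_in.
apply/msem_and; split; [apply/msem_and; split|].
- apply/msem_all => i; rewrite mem_iota => /= ilt; apply/tsem_nexts.
  by rewrite ilt; apply: ptrace_kind.
- apply/msem_sync_until_acc => //; exists (x.+1 + m); rewrite n_gt0; split.
    exact: ptrace_acc Hm.
  by move=> i t ilt _; rewrite ilt; apply: (@ptrace_sync _ n).
- by apply/tsem_nexts; rewrite n_gt0; apply: ptrace_start; lia.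
Qed.

(** * Computing the code of an instance *)

(** In the token string of a tree, [inl k.+1] opens a node labelled [k], [inr a] is a leaf and
    [inl 0] closes a node. *)
Definition token : Type := (nat + nat)%type.
Definition codes (s : seq token) : seq nat := [seq pickle z | z <- s].
Notation tok_close := (@inl nat nat 0).

Lemma pickle_tree (t : GenTree.tree nat) :
  pickle t = CodeSeq.code (codes (GenTree.encode t)).
Proof. by []. Qed.

Lemma nseq_cat1 m : nseq m tok_close ++ [:: tok_close] = nseq m.+1 tok_close.
Proof. by rewrite -[[:: _]]/(nseq 1 tok_close) -nseqD addn1. Qed.

Lemma encode_Exs s p : GenTree.encode (h_tree (Exs s p)) =
  flatten [seq [:: inl 1; inr i] | i <- s] ++
  (inl 3 :: GenTree.encode (m_tree p)) ++ nseq (size s + 1) tok_close.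
Proof.
elim: s => [|a s IHs] /=; first by rewrite cats0 cats1.
by rewrite cats0 IHs -cats1 /= -!catA /= -catA nseq_cat1 -addSn.
Qed.

Lemma encode_nexts x d : GenTree.encode (t_tree (iter x (TNext Sg) d)) =
  flatten (nseq x [:: inl 5; inr 0]) ++ GenTree.encode (t_tree d) ++
  nseq x tok_close.
Proof.
elim: x => [|x IHx] /=; first by rewrite cats0.
by rewrite IHx cats0 -cats1 -!catA nseq_cat1.
Qed.

Definition input_prefix (pd : pds) (n : nat) : seq token :=
  (inl 1 :: GenTree.encode (pd_tree pd)) ++
  flatten [seq [:: inl 1; inr i] | i <- iota 0 n] ++
  [:: inl 3, inl 4, inl 3, inl 4 &
     GenTree.encode (m_tree (MAnd (kinds n) (sync_until_acc n)))] ++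
  [:: tok_close; inl 4; inl 1].

(** After the tower and its trace variable, [n] closings belong to the quantifiers and six to [MAt],
    the two negations and the disjunction of [MAnd], [HM] and the pair. *)
Definition input_suffix (n x : nat) : seq token :=
  flatten (nseq x [:: inl 5; inr 0]) ++ [:: inl 1; inr a_start; tok_close] ++
  nseq x tok_close ++ [:: inr 0] ++
  nseq n tok_close ++ nseq 6 tok_close.

Lemma encode_and p q : GenTree.encode (m_tree (MAnd p q)) =
  [:: inl 4, inl 3, inl 4 & GenTree.encode (m_tree p)] ++ [:: tok_close; inl 4] ++
  GenTree.encode (m_tree q) ++ nseq 3 tok_close.
Proof. by rewrite /= !cats0 -!cats1 /= -!catA /= -!catA. Qed.

Lemma encode_start_at x : GenTree.encode (m_tree (start_at x)) =
  (inl 1 :: flatten (nseq x [:: inl 5; inr 0])) ++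
  [:: inl 1; inr a_start; tok_close] ++ nseq x tok_close ++ [:: inr 0; tok_close].
Proof.
have -> d : GenTree.encode (m_tree (MAt d 0)) =
    inl 1 :: GenTree.encode (t_tree d) ++ [:: inr 0; tok_close].
  by rewrite /= -cats1 -catA.
by rewrite encode_nexts -!catA.
Qed.

Lemma encode_inputE pd n x : encode_input pd (formula n x) =
  CodeSeq.code (codes (input_prefix pd n ++ input_suffix n x)).
Proof.
rewrite /encode_input pickle_tree; congr (CodeSeq.code (codes _)).
rewrite /input_prefix /input_suffix /formula; move: (pd_tree pd) => t.
rewrite [GenTree.encode _]/= cats0 encode_Exs encode_and encode_start_at size_iota.
move: (GenTree.encode (m_tree _)) => b; move: (GenTree.encode t) => u.
have -> : [:: inr 0] ++ nseq n tok_close ++ nseq 6 tok_close =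
    [:: inr 0; tok_close] ++ nseq 3 tok_close ++ nseq (n + 1) tok_close ++ [:: tok_close].
  rewrite nseq_cat1 -!nseqD; congr (_ :: _).
  by rewrite -[RHS]/(nseq (1 + (3 + (n + 1).+1)) tok_close); congr nseq; lia.
by rewrite -cats1; do 4!rewrite /= -!catA.
Qed.

(** The string is built from its right end; the result is shifted by the bit length of [x] and [x]
    is added, which puts the prefix coded by [x] in front. *)
Definition pencode (A C : seq nat) (z a0 c : nat) : prf :=
  let close_n := pcomp (piter (pprepend [:: z])) [:: pproj 1; pconst c] in
  let close_x := pcomp (piter (pprepend [:: z]))
    [:: pproj 0; pcomp (pprepend [:: a0]) [:: close_n]] in
  let suffix := pcomp (piter (pprepend A)) [:: pproj 0; pcomp (pprepend C) [:: close_x]] in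
  pcomp (piter psucc) [:: pproj 0; pcomp (piter pdbl) [:: pbitlen; suffix]].

Lemma peval_encode A C z a0 c p n :
  let x := CodeSeq.code p in p != [::] ->
  peval (pencode A C z a0 (CodeSeq.code c)) [:: x; n]
    (CodeSeq.code (p ++ flatten (nseq x A) ++ C ++ nseq x z ++ [:: a0] ++ nseq n z ++ c)).
Proof.
move=> x p0; have [L [HL ->]] := code_cat_bitlen p0.
have nseqE k : nseq k z = flatten (nseq k [:: z]) by elim: k => //= k ->.
rewrite !nseqE code_nseq_cat code_cat code_nseq_cat code_cat code_nseq_cat.
have -> q : CodeSeq.code p + q = iter x succn q.
  by rewrite -/x; elim: (x) => //= m <-.
have P0 : peval (pproj 0) [:: x; n] x by apply: peval_proj.
have P1 : peval (pproj 1) [:: x; n] n by apply: peval_proj.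
rewrite -iter_double.
apply: (peval_comp2 P0 _ (peval_iter (fun m => pe_succ [:: m]) _ _)).
apply: (peval_comp2 (peval_bitlen _ HL) _ (peval_iter peval_dbl _ _)).
have Hp := peval_prepend.
apply: (peval_comp2 P0 (peval_comp1 _ (Hp _ _)) (peval_iter (Hp A) _ _)).
apply: (peval_comp2 P0 (peval_comp1 _ (Hp _ _)) (peval_iter (Hp [:: z]) _ _)).
exact: peval_comp2 P1 (peval_const _ _) (peval_iter (Hp [:: z]) _ _).
Qed.

Definition pinput : prf :=
  pencode (codes [:: inl 5; inr 0]) (codes [:: inl 1; inr a_start; tok_close])
    (pickle tok_close) (pickle (inr 0 : token)) (CodeSeq.code (codes (nseq 6 tok_close))).

Lemma peval_input pd n :
  let x := CodeSeq.code (codes (input_prefix pd n)) in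
  n < x /\ peval pinput [:: x; n] (encode_input pd (formula n x)).
Proof.
move=> x; split.
  apply: leq_trans (size_le_code _); rewrite size_map /input_prefix !size_cat.
  rewrite size_flatten /shape -map_comp /=.
  (* Each quantifier contributes two tokens, so the prefix has more than [n] of them. *)
  have -> : sumn [seq size [:: inl 1; inr i : token] | i <- iota 0 n] = n.*2.
    by rewrite -{2}(size_iota 0 n); elim: (iota 0 n) => //= _ s ->.
  lia.
have codesE (p a b d e : seq token) k l : codes (p ++ flatten (nseq k a) ++
    b ++ nseq k tok_close ++ d ++ nseq l tok_close ++ e) =
  codes p ++ flatten (nseq k (codes a)) ++ codes b ++ nseq k (pickle tok_close) ++
    codes d ++ nseq l (pickle tok_close) ++ codes e.
  by rewrite /codes !map_cat map_flatten !map_nseq.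
rewrite encode_inputE codesE.
exact: peval_encode.
Qed.

(** * The diagonal argument *)

Section SelfReference.
Variables (body : cmd) (n : nat).
Hypothesis n_gt2 : 2 < n.
Hypothesis body_regs : all (fun r => r < n) (cregs body).

(* Register [0] is loaded by the formula, register [1] by the program itself. *)
Definition program : cmd := iter n (CSeq (CInc 1)) body.
Definition psize : nat := csize program.
(** Both targets of the last test lie past the code, where the machine halts; the accepting one,
    [psize.+1], is taken when the output in register 2 is 0. *)
Definition pcode : seq instr := assemble program 0 psize ++ [:: IJzd 2 psize.+1 psize.+2].
Definition pbound : nat := (sumn (flatten (map itargets pcode)) + n).+1.
Definition self_pds : pds := automaton pcode n pbound psize.+1.
(** There is no circularity: neither the automaton nor the rest of the prefix mentions the value to
    be loaded. *)
Definition self_code : nat := CodeSeq.code (codes (input_prefix self_pds n)).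
Definition self_formula : hform := formula n self_code.

Lemma pcode_regs : all (fun i => all (fun r => r < n) (ireg i)) pcode.
Proof.
rewrite /pcode all_cat /= !andbT n_gt2 andbT; apply: assemble_regs.
by rewrite /program; elim: {2}n => //= k ->; rewrite andbT ltnW.
Qed.

Lemma pcode_targets : all (fun i => all (fun l => l < pbound) (itargets i)) pcode.
Proof.
have: all (fun l => l < pbound) (flatten (map itargets pcode)).
  by apply/allP => l /leq_sumn; rewrite /pbound; lia.
by elim: pcode => //= i c IHc; rewrite all_cat => /andP[-> /IHc].
Qed.

Lemma self_wf : wf_input 4 self_formula.
Proof. by apply: formula_wf; apply: ltn_trans n_gt2. Qed.

Lemma self_models : hmodels (pd_trace 4 self_pds) self_formula <->
  exists m, (conf pcode self_code m).1 = (None, psize.+1).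
Proof.
apply: formula_models.
- by lia.
- by have [] := peval_input self_pds n.
- by rewrite /pbound; lia.
- exact: pcode_regs.
- exact: pcode_targets.
Qed.

Lemma program_exec y :
  (forall s, s 0 = self_code -> s 1 = n -> exists s', exec body s s' /\ s' 2 = y) ->
  exists s, exec program (input_regs self_code) s /\ s 2 = y.
Proof.
move=> Hbody.
suff H k s : s 0 = self_code -> s 1 + k = n ->
    exists s', exec (iter k (CSeq (CInc 1)) body) s s' /\ s' 2 = y.
  by apply: H.
elim: k s => [|k IHk] s s0 s1; first by apply: Hbody; rewrite // -s1 addn0.
have [||s' [ex s2]] := IHk (updV s 1 (s 1).+1) => //.
  by rewrite updVE eqxx addSnnS.
by exists s'; split=> //=; apply: ex_seq ex; apply: ex_inc.
Qed.

Lemma program_halts y :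
  (forall s, s 0 = self_code -> s 1 = n -> exists s', exec body s s' /\ s' 2 = y) ->
  exists s, reaches pcode (None, 0, input_regs self_code)
                          (None, if y == 0 then psize.+1 else psize.+2, s).
Proof.
move=> /program_exec [s [ex s2]].
have [H1 H2] : code_at pcode 0 (assemble program 0 psize) /\
    code_at pcode (0 + size (assemble program 0 psize)) [:: IJzd 2 psize.+1 psize.+2].
  by apply: code_at_cat => j _; rewrite add0n.
have Hrun := assembleP ex H1; move: H2; rewrite add0n size_assemble.
move=> /code_at_cons [F _].
have [y0|y0] := eqVneq y 0; eexists; apply: reaches_trans Hrun (reaches_step _).
  by rewrite /= F s2 y0; apply: reaches_step; apply: reaches_refl.
by rewrite /= F s2 (negPf y0); apply: reaches_refl.
Qed.

Lemma cstep_after_program l s : psize < l -> cstep pcode (None, l, s) = (None, l, s).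
Proof.
move=> pl; rewrite /= /fetch nth_default //.
by rewrite size_cat size_assemble /= addn1.
Qed.

End SelfReference.

Lemma body_exec f body n y : body = compile (pcomp f [:: pinput]) [:: 0; 1] 2 3 ->
  peval f [:: encode_input (self_pds body n) (self_formula body n)] y ->
  forall s, s 0 = self_code body n -> s 1 = n -> exists s', exec body s s' /\ s' 2 = y.
Proof.
move=> bodyE fy s s0 s1.
have ev : peval (pcomp f [:: pinput]) [:: self_code body n; n] y.
  by apply: peval_comp1 fy; have [] := peval_input (self_pds body n) n.
have [||||s' [ex [s2 _]]] := @compileP _ [:: 0; 1] 2 3 s _ _ ev => //.
  by rewrite -[map _ _]/([:: s 0; s 1]) s0 s1.
by exists s'; rewrite bodyE.
Qed.

Lemma not_decides f : ~ decides_mc 4 f.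
Proof.
(* The body is hidden behind an equation so that the compiled program stays folded. *)
have [body bodyE] : exists body, body = compile (pcomp f [:: pinput]) [:: 0; 1] 2 3.
  by exists (compile (pcomp f [:: pinput]) [:: 0; 1] 2 3).
have [n [n_gt2 n_regs]] : exists n, 2 < n /\ all (fun r => r < n) (cregs body).
  exists (sumn (cregs body)).+3; split=> //.
  by apply/allP => r /leq_sumn; lia.
move=> /(_ (self_pds body n) (self_formula body n) (self_wf body n_gt2)) [Hyes Hno].
have Hmodels := self_models n_gt2 n_regs.
have [yes|no] := classic (hmodels (pd_trace 4 (self_pds body n)) (self_formula body n)).
  (* The answer 1 makes the machine halt at [psize.+2], while truth of the formula makes it halt at
     [psize.+1]. *)
  have [s Hrej] := program_halts (body_exec bodyE (Hyes yes)).
  have /Hmodels [m Hm] := yes.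
  have Hacc : reaches (pcode body n) (None, 0, input_regs (self_code body n))
      (None, (psize body n).+1, (conf (pcode body n) (self_code body n) m).2).
    by exists m; rewrite -Hm -surjective_pairing.
  have := reaches_halt Hrej Hacc (cstep_after_program _ (leqnSn _))
    (cstep_after_program _ (leqnn _)).
  by case; lia.
(* The answer 0 makes the machine accept, so the formula holds after all. *)
have [s [m Hm]] := program_halts (body_exec bodyE (Hno no)).
by apply/no/Hmodels; exists m; rewrite /conf Hm.
Qed.

Theorem theorem5p1 : exists k : nat, ~ exists f : prf, decides_mc k f.
(* The four propositions are [a_sync], [a_acc], [a_start] and [a_kind]. *)
Proof. by exists 4 => -[f]; apply: not_decides. Qed.
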